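(* Assume Assumptions (A1)–(A3) hold, let $g^*,h^*$ be limits $g^*=\lim_k\alpha_{n_k}J^*_{\alpha_{n_k}}(i_0)$, $h^*(j)=\lim_kh_{\alpha_{n_k}}(j)$ along a subsequence, satisfying the average-cost optimality inequality $g^*\ge\min_{a\in A(i)}\{c(i,a)+\sum_jh^*(j)q(j|i,a)\}$ for all $i\in S$, and let $e$ be a stationary policy attaining this minimum for every $i$. Define $\Phi\ge0$ by $$g^*=c(i,e(i))+\Phi(i)+\sum_{j\in S}q(j|i,e(i))h^*(j),\quad i\in S.$$ Let $i\in S$. Then $\Phi(i)=0$ (so the optimality equality $g^*=\min_{a\in A(i)}\{c(i,a)+\sum_jh^*(j)q(j|i,a)\}$ holds at $i$) under any of the following conditions: (i) there is a nonempty set $G\subseteq S$ with $e\in\mathfrak R(i,G)$ and $\sum_{j\in G}H(j)P_e(x(T)=j\mid x(0)=i)<\infty$, where $T$ is the first passage time from $i$ to $G$; (ii) $e\in\mathfrak R(i,i_0)$; (iii) the Markov chain induced by $e$ is positive recurrent at $i$; (iv) $\sum_{j\in S}|q(j|i,a)|H(j)<\infty$ for all $a\in A(i)$.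
   Context: CTMDP: denumerable state space $S$, finite action sets $A(i)$, conservative transition rates $q(j|i,a)$ ($q(j|i,a)\ge0$ for $j\ne i$, $\sum_jq(j|i,a)=0$), cost rates $c(i,a)\ge0$; processes nonexplosive. $J^*_\alpha(i)=\inf_{\pi}\int_0^\infty e^{-\alpha t}E_i^\pi[c(x(t),\pi_t)]dt$ over randomized Markov policies. Assumptions A: for some decreasing sequence $\alpha_n\to0$ and some state $i_0$: (A1) $\alpha_nJ^*_{\alpha_n}(i_0)$ is bounded in $n$; (A2) there is a finite nonnegative function $H$ with $h_{\alpha_n}(i)\le H(i)$ for all $i,n$, where $h_\alpha(i)=J^*_\alpha(i)-J^*_\alpha(i_0)$; (A3) there is a constant $L\ge0$ with $-L\le h_{\alpha_n}(i)$ for all $i,n$. The first passage time from $i$ to $G$ is $T=\inf\{t>0:x(t)\in G$, at least one transition has occurred$\}$. $\mathfrak R(i,G)$ is the class of policies $\theta$ with $P_\theta(T<\infty\mid x(0)=i)=1$ and $m_{i,G}(\theta):=E_\theta[T\mid x(0)=i]<\infty$; $\mathfrak R(i,x):=\mathfrak R(i,\{x\})$. *)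

(* Defs.v *)
From HB Require Import structures.
From mathcomp Require Import all_boot all_order all_algebra.
From mathcomp Require Import finmap.
From mathcomp Require Import all_classical all_reals all_analysis.
Set Implicit Arguments.
Unset Strict Implicit.
Unset Printing Implicit Defensive.
Import Order.TTheory GRing.Theory Num.Theory.
Import numFieldNormedType.Exports.
Local Open Scope classical_set_scope.
Local Open Scope ring_scope.

Section CTMDP.
Variables (R : realType) (S : countType) (Act : choiceType).
Variable A : S -> {fset Act}.
(* q i a j = q(j | i, a) : transition rates *)
Variable q : S -> Act -> S -> R.
Variable c : S -> Act -> R.

Local Open Scope ereal_scope.

Definition sumS (f : S -> R) : \bar R :=
  \esum_(j in setT) (Num.max (f j) 0)%:E - \esum_(j in setT) (Num.max (- f j) 0)%:E.

Definition actmin (i : S) (F : Act -> \bar R) : \bar R :=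
  \big[mine/+oo]_(a <- A i) F a.

(* Randomized Markov policies: pi t i a = pi_t(a | i), measurable in t *)
Definition is_policy (pi : R -> S -> Act -> R) : Prop :=
  (forall t i a, (0 <= pi t i a)%R) /\
  (forall t i, (\sum_(a <- A i) pi t i a)%R = 1%R) /\
  (forall i a, measurable_fun setT (fun t => pi t i a)).

Definition qpol (pi : R -> S -> Act -> R) (t : R) (i j : S) : R :=
  (\sum_(a <- A i) q i a j * pi t i a)%R.

Definition qexit (pi : R -> S -> Act -> R) (t : R) (i : S) : R :=
  (- qpol pi t i i)%R.

Definition leb := (@lebesgue_measure R).

(* Feller's (minimal) construction of the transition function
   P^pi(s, i, t, j) of the nonhomogeneous chain with Q-matrix q(. | ., pi_t) *)
Fixpoint Pn (pi : R -> S -> Act -> R) (n : nat) (s : R) (i : S) (t : R) (j : S)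
  : \bar R :=
  match n with
  | 0 => if i == j then
           expeR (- \int[leb]_(v in `[s, t]) (qexit pi v i)%:E)
         else 0
  | n'.+1 =>
      \int[leb]_(u in `[s, t])
        (expeR (- \int[leb]_(v in `[s, u]) (qexit pi v i)%:E) *
         \esum_(k in [set k | k != i]) ((qpol pi u i k)%:E * Pn pi n' u k t j))
  end.

Definition Ptrans (pi : R -> S -> Act -> R) (s : R) (i : S) (t : R) (j : S)
  : \bar R :=
  \esum_(n in setT) Pn pi n s i t j.

Definition Jdisc (alpha : R) (pi : R -> S -> Act -> R) (i : S) : \bar R :=
  \int[leb]_(t in `[0%R, +oo[)
    ((expR (- alpha * t))%:E *
     \esum_(j in setT)
       (Ptrans pi 0 i t j * (\sum_(a <- A j) pi t j a * c j a)%:E)).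

Definition Jstar (alpha : R) (i : S) : \bar R :=
  ereal_inf [set Jdisc alpha pi i | pi in is_policy].

Definition hrel (alpha : R) (i0 i : S) : \bar R := Jstar alpha i - Jstar alpha i0.

Definition nonexplosive : Prop :=
  forall pi, is_policy pi -> forall (s t : R) (i : S), (s <= t)%R ->
    \esum_(j in setT) Ptrans pi s i t j = 1.

(* ---- The continuous-time Markov chain induced by a stationary policy e,
   described via its jump chain and exponential holding times. ---- *)
Section Stationary.
Variable e : S -> Act.

Definition qe (i : S) : R := (- q i (e i) i)%R.

(* jump chain transition probabilities (zero row at absorbing states:
   no further transition ever occurs there) *)
Definition pjump (l k : S) : R :=
  if l == k then 0%R else (q l (e l) k / qe l)%R.

(* taboo probabilities: probability that the jump chain started at i
   is at k after n jumps, not having visited G at jumps 1..n *)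
Fixpoint taboo (i : S) (G : set S) (n : nat) (k : S) : \bar R :=
  match n with
  | 0 => if k == i then 1 else 0
  | n'.+1 => if k \in G then 0
             else \esum_(l in setT) (taboo i G n' l * (pjump l k)%:E)
  end.

(* P_e(x(T) = j, T < oo | x(0) = i), T the first passage time to G
   (after at least one transition) *)
Definition fpdist (i : S) (G : set S) (j : S) : \bar R :=
  if j \in G then
    \esum_(n in setT) \esum_(l in setT) (taboo i G n l * (pjump l j)%:E)
  else 0.

Definition hitprob (i : S) (G : set S) : \bar R :=
  \esum_(j in G) fpdist i G j.

(* m_{i,G}(e) = E_e[T | x(0) = i]: sum of mean holding times before T *)
Definition mfp (i : S) (G : set S) : \bar R :=
  if hitprob i G == 1 then
    \esum_(n in setT) \esum_(l in setT) (taboo i G n l * ((qe l)^-1)%:E)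
  else +oo.

Definition inRclass (i : S) (G : set S) : Prop :=
  hitprob i G = 1 /\ mfp i G < +oo.

(* positive recurrence at i of the chain induced by e (Norris): either i is
   absorbing, or the return time has probability one and finite mean *)
Definition posrec (i : S) : Prop :=
  qe i = 0%R \/ inRclass i [set i].

End Stationary.
End CTMDP.

(* Main.v *)
Require Import Defs.
From HB Require Import structures.
From mathcomp Require Import all_boot all_order all_algebra.
From mathcomp Require Import finmap.
From mathcomp Require Import all_classical all_reals all_analysis.
From mathcomp Require Import measurable_realfun.
From mathcomp Require Import ring lra.
Set Implicit Arguments.
Unset Strict Implicit.
Unset Printing Implicit Defensive.
Import Order.TTheory GRing.Theory Num.Theory.
Import numFieldNormedType.Exports.
Local Open Scope classical_set_scope.
Local Open Scope ring_scope.

(** For a fixed discount rate [alpha], [Jstar] is the least nonnegative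
    supersolution of the Bellman equation. Minimality comes from the stationary
    policy that selects an action witnessing the supersolution property; that
    [Jstar] is itself a supersolution comes from decomposing the cost of an
    arbitrary Markov policy at its first jump in Feller's construction.

    Minimality yields two upper bounds on [Jstar]: the Bellman inequality for
    every action, and, outside [G], [Jstar] is at most the expected undiscounted
    cost of following [e] up to the first passage to [G] and paying [Jstar]
    there. The second bound makes the remainder vanish when the Bellman
    inequality for [h_alpha + L >= 0] is iterated along the jump chain of [e]
    up to the passage time [T]:
      [h_alpha(i) + L + alpha Jstar(i0) E T
         <= E int_0^T c + alpha L E T + E (h_alpha(x_T) + L)].
    Letting [alpha] tend to [0], with [H] dominating the last term, and comparing
    with the iterated defining equation of [Phi], whose remainder is nonnegative,
    gives [E int_0^T Phi <= 0], hence [Phi i = 0]. Condition (iv) and absorbing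
    states need one step of the Bellman inequality only. *)

(** * Integrals of exponential survival functions *)

Section QuadraticIncrements.
Context {R : realType}.

(** Cutting [[s, t]] into [n + 1] equal pieces bounds the total change by [Q (t - s)^2 / (n + 1)].
    This stands in for differentiating an integral whose integrand is only measurable. *)
Lemma quadratic_increments_const (D : R -> R) (Q s t : R) : s <= t ->
  (forall a b, s <= a -> a <= b -> `|D b - D a| <= Q * (b - a) ^+ 2) ->
  D t = D s.
Proof.
move=> st hD.
have step (h : R) k : 0 <= h -> `|D (s + h *+ k) - D s| <= (Q * h ^+ 2) *+ k.
  move=> h0; elim: k => [|k IH]; first by rewrite !mulr0n addr0 subrr normr0.
  have -> : D (s + h *+ k.+1) - D s =
    (D (s + h *+ k) - D s) + (D (s + h *+ k.+1) - D (s + h *+ k)) by ring.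
  rewrite [leRHS]mulrSr; apply: le_trans (ler_normD _ _) (lerD IH _).
  have := hD (s + h *+ k) (s + h *+ k.+1).
  have -> : s + h *+ k.+1 - (s + h *+ k) = h by rewrite mulrSr; ring.
  apply; first by rewrite lerDl mulrn_wge0.
  by rewrite lerD2l mulrSr lerDl.
apply/eqP; rewrite -subr_eq0 -normr_le0; apply/ler_addgt0Pl => e e0.
rewrite addr0.
pose X := `|Q * (t - s) ^+ 2|.
have [n hn] : exists n : nat, X / e < n.+1%:R.
  exists (Num.bound (X / e)); apply: (@lt_le_trans _ _ (Num.bound (X / e))%:R).
    by apply: archi_boundP; rewrite divr_ge0 ?normr_ge0 ?(ltW e0).
  by rewrite ler_nat.
have n0 : (0 : R) < n.+1%:R by [].
have := step ((t - s) / n.+1%:R) n.+1.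
have -> : s + ((t - s) / n.+1%:R) *+ n.+1 = t.
  by rewrite -mulr_natr divfK ?gt_eqF//; ring.
move=> /(_ _)/le_trans; apply; first by rewrite divr_ge0 ?subr_ge0.
have -> : (Q * ((t - s) / n.+1%:R) ^+ 2) *+ n.+1 = Q * (t - s) ^+ 2 / n.+1%:R.
  by rewrite -mulr_natr; field; rewrite gt_eqF.
rewrite ler_pdivrMr// [leRHS]mulrC; apply: le_trans (ler_norm _) _.
by rewrite -ler_pdivrMr// ltW.
Qed.

(** Both bounds come from [1 + x <= exp x]: at [x = d] it gives [exp (- d) <= 1 / (1 + d)], at
    [x = - d] it gives [exp (- d) >= 1 - d]. *)
Lemma expR_remainder (d : R) : 0 <= d ->
  d + expR (- d) - 1 <= d ^+ 2 /\ - d ^+ 2 <= expR (- d) * (1 + d) - 1.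
Proof.
move=> d0; have e1 := expR_ge1Dx d; have e2 := expR_ge1Dx (- d).
have eM : expR (- d) * expR d = 1 by rewrite -expRD addNr expR0.
have ep := expR_gt0 (- d); split; nra.
Qed.

End QuadraticIncrements.

Section CumulativeRate.
Context {R : realType}.
Implicit Types (f lam : R -> R) (a b s t u alpha C : R).
Local Notation leb := (@lebesgue_measure R).

Lemma bounded_integrable_itv f a b C : measurable_fun setT f ->
  (forall x, a <= x -> x <= b -> `|f x| <= C) ->
  leb.-integrable `[a, b] (EFin \o f).
Proof.
move=> mf fC; apply: measurable_bounded_integrable => //.
- by rewrite /= lebesgue_measure_itv/=; case: ifP => _; rewrite ?ltry// -EFinB ltry.
- exact: measurable_funTS.
- exists C; split; first by rewrite num_real.
  move=> M CM x /=; rewrite in_itv/= => /andP[ax xb].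
  exact: le_trans (fC _ ax xb) (ltW CM).
Qed.

Lemma Rintegral_itvD f a b t C : measurable_fun setT f ->
  (forall x, a <= x -> x <= b -> `|f x| <= C) -> a <= t -> t <= b ->
  (\int[leb]_(x in `[a, b]) f x =
   \int[leb]_(x in `[a, t]) f x + \int[leb]_(x in `[t, b]) f x)%R.
Proof.
move=> mf fC at_ tb.
have itb : leb.-integrable `[t, b] (EFin \o f).
  by apply: (@bounded_integrable_itv _ _ _ C) => // x tx; apply: fC; apply: le_trans tx.
have := @Rintegral_itvB R f (BLeft a) (BRight b) t.
rewrite Rintegral_itv_obnd_cbnd; last first.
  by apply: integrableS itb => //; apply: subset_itvr; rewrite bnd_simp.
move=> <-; [by rewrite addrC subrK| |by []|by []].
exact: bounded_integrable_itv mf fC.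
Qed.

Lemma fine_measure_itvcc a b : a <= b -> fine (leb `[a, b]) = b - a.
Proof.
move=> ab; rewrite lebesgue_measure_itv/= lte_fin.
case: ltP => //= ba; have -> : b = a by apply/eqP; rewrite eq_le ba.
by rewrite subrr.
Qed.

Definition cumul lam t : R := (\int[leb]_(v in `[0%R, t]) lam v)%R.

Definition bounded_rate lam C :=
  measurable_fun setT lam /\ forall t, 0 <= lam t /\ lam t <= C.

Section Rate.
Variables (lam : R -> R) (C : R).
Hypothesis lamC : bounded_rate lam C.

Let mlam : measurable_fun setT lam. Proof. by case: lamC. Qed.
Let normlam x : `|lam x| <= C.
Proof. by case: lamC => _ /(_ x)[h0 hC]; rewrite ger0_norm. Qed.

Lemma Rintegral_rate s t : 0 <= s -> s <= t ->
  (\int[leb]_(v in `[s, t]) lam v)%R = cumul lam t - cumul lam s.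
Proof.
move=> s0 st; rewrite /cumul (@Rintegral_itvD lam 0 t s C)//.
by rewrite [RHS]addrC addrA addNr add0r.
Qed.

Lemma integral_rate s t : 0 <= s -> s <= t ->
  (\int[leb]_(v in `[s, t]) (lam v)%:E = (cumul lam t - cumul lam s)%:E)%E.
Proof.
move=> s0 st; rewrite -Rintegral_rate// fineK//; apply: integrable_fin_num => //.
exact: (@bounded_integrable_itv _ _ _ C).
Qed.

Lemma cumul_le s t : s <= t -> cumul lam s <= cumul lam t.
Proof.
move=> st; have [s0|s0] := leP 0 s.
  rewrite -subr_ge0 -Rintegral_rate//; apply: Rintegral_ge0 => v _.
  by case: lamC => _ /(_ v)[].
(* For [s < 0] the interval [[0, s]] is empty. *)
have -> : cumul lam s = 0.
  by rewrite /cumul set_itv_ge ?bnd_simp -?ltNge// Rintegral_set0.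
by apply: Rintegral_ge0 => v _; case: lamC => _ /(_ v)[].
Qed.

Lemma cumul_lip s t : 0 <= s -> s <= t -> cumul lam t - cumul lam s <= C * (t - s).
Proof.
move=> s0 st; rewrite -Rintegral_rate// -(fine_measure_itvcc st) -Rintegral_cst//.
apply: le_Rintegral => //.
- exact: (@bounded_integrable_itv _ _ _ C).
- by apply: (@bounded_integrable_itv _ _ _ `|C|) => //; exact: measurable_cst.
- by move=> x _; case: lamC => _ /(_ x)[].
Qed.

Lemma measurable_cumul : measurable_fun setT (cumul lam).
Proof. by apply: nondecreasing_measurable => // s t; exact: cumul_le. Qed.

Lemma cumul_ge0 t : 0 <= cumul lam t.
Proof. by apply: Rintegral_ge0 => v _; case: lamC => _ /(_ v)[]. Qed.

Let g u := lam u * expR (- cumul lam u).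

Let mg : measurable_fun setT g.
Proof.
apply: measurable_funM => //; apply: measurableT_comp; first exact: measurable_expR.
by apply: measurable_funN; exact: measurable_cumul.
Qed.

Let C0 : 0 <= C. Proof. exact: le_trans (normr_ge0 _) (normlam 0). Qed.

Let gC x : `|g x| <= C.
Proof.
rewrite normrM (ger0_norm (expR_ge0 _)) -[leRHS]mulr1 ler_pM// -expR0 ler_expR.
by rewrite oppr_le0 cumul_ge0.
Qed.

(** The integral plus [exp (- cumul lam b)] is constant in [b] because its increments are quadratic.
    On [[a, b]] the exponential is squeezed between its endpoint values, so the integral lies
    between these values times [d = cumul lam b - cumul lam a]; [expR_remainder] leaves an error of
    at most [d^2], and [d <= C (b - a)]. *)
Lemma Rintegral_rate_expR s t : 0 <= s -> s <= t ->
  (\int[leb]_(u in `[s, t]) (lam u * expR (- cumul lam u)))%R =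
  expR (- cumul lam s) - expR (- cumul lam t).
Proof.
move=> s0 st.
pose I a b := (\int[leb]_(u in `[a, b]) g u)%R.
pose D b := I s b + expR (- cumul lam b).
suff : D t = D s.
  rewrite /D /I set_itv1 Rintegral_set1 add0r => <-.
  by rewrite addrK.
apply: (@quadratic_increments_const _ D (C ^+ 2)) => // a b sa ab.
have a0 := le_trans s0 sa.
have -> : D b - D a = I a b + expR (- cumul lam b) - expR (- cumul lam a).
  have E (x y z w : R) : x + y + z - (x + w) = y + z - w by ring.
  by rewrite /D /I (@Rintegral_itvD g s b a C)// E.
set d := cumul lam b - cumul lam a.
have d0 : 0 <= d by rewrite subr_ge0 cumul_le.
have dC : d <= C * (b - a) by exact: cumul_lip.
have ea : expR (- cumul lam a) <= 1 by rewrite -expR0 ler_expR oppr_le0 cumul_ge0.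
have eb : expR (- cumul lam b) = expR (- cumul lam a) * expR (- d).
  by rewrite -expRD /d; congr expR; ring.
have ilam : leb.-integrable `[a, b] (EFin \o lam).
  exact: (@bounded_integrable_itv _ _ _ C).
have ig : leb.-integrable `[a, b] (EFin \o g).
  exact: (@bounded_integrable_itv _ _ _ C).
have izl r : leb.-integrable `[a, b] (EFin \o (fun x => r * lam x)).
  apply: (@bounded_integrable_itv _ _ _ (`|r| * C)).
    by apply: measurable_funM => //; exact: measurable_cst.
  by move=> x _ _; rewrite normrM ler_wpM2l.
have up : I a b <= expR (- cumul lam a) * d.
  rewrite /d -Rintegral_rate// -RintegralZl//; apply: le_Rintegral => // x.
  rewrite /= in_itv/= => /andP[ax xb]; rewrite /g mulrC ler_wpM2r//.
    by case: lamC => _ /(_ x)[].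
  by rewrite ler_expR lerN2 cumul_le.
have lo : expR (- cumul lam b) * d <= I a b.
  rewrite /d -Rintegral_rate// -RintegralZl//; apply: le_Rintegral => // x.
  rewrite /= in_itv/= => /andP[ax xb]; rewrite /g mulrC ler_wpM2l//.
    by case: lamC => _ /(_ x)[].
  by rewrite ler_expR lerN2 cumul_le.
have [r1 r2] := expR_remainder d0.
have dd : d ^+ 2 <= C ^+ 2 * (b - a) ^+ 2.
  by rewrite -exprMn ler_sqr ?nnegrE// mulr_ge0// subr_ge0.
have ep := expR_ge0 (- cumul lam a).
apply: le_trans dd; rewrite ler_norml eb; move: up lo; rewrite eb.
move: (I a b) (expR (- cumul lam a)) (expR (- d)) ep ea r1 r2 => x E e.
clear => E0 E1 r1 r2 up lo.
have k1 : E * (d + e - 1) <= E * d ^+ 2 by rewrite ler_wpM2l.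
have k2 : E * (- d ^+ 2) <= E * (e * (1 + d) - 1) by rewrite ler_wpM2l.
have k3 : E * d ^+ 2 <= d ^+ 2 by rewrite ler_piMl// sqr_ge0.
by move: (d ^+ 2) k1 k2 k3 => d2 k1 k2 k3; apply/andP; split; lra.
Qed.

End Rate.

Lemma bounded_rateD alpha lam C : 0 <= alpha -> bounded_rate lam C ->
  bounded_rate (fun u => alpha + lam u) (alpha + C).
Proof.
move=> a0 [mlam lamC]; split.
  by apply: measurable_funD => //; exact: measurable_cst.
by move=> t; have [? ?] := lamC t; rewrite addr_ge0// lerD2l.
Qed.

Lemma cumulD alpha lam C t : 0 <= alpha -> bounded_rate lam C -> 0 <= t ->
  cumul (fun u => alpha + lam u) t = alpha * t + cumul lam t.
Proof.
move=> a0 [mlam lamC] t0.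
have ic : leb.-integrable `[0, t] (EFin \o cst alpha).
  by apply: (@bounded_integrable_itv _ _ _ `|alpha|) => //; exact: measurable_cst.
rewrite /cumul RintegralD//.
  by rewrite (@Rintegral_cst _ _ _ leb)// fine_measure_itvcc// subr0.
apply: (@bounded_integrable_itv _ _ _ C) => // x _ _.
by have [? ?] := lamC x; rewrite ger0_norm.
Qed.

(* Probability of no jump in [[s, u]], set to [0] unless [0 <= s <= u] so that
   integrals over [[s, t]] become integrals over the whole line. *)
Definition survival lam s u : R :=
  if (0 <= s) && (s <= u) then expR (cumul lam s - cumul lam u) else 0.

Lemma survival_ge0 lam s u : 0 <= survival lam s u.
Proof. by rewrite /survival; case: ifP. Qed.

Lemma measurable_survival lam C : bounded_rate lam C ->
  measurable_fun setT (fun p : R * R => survival lam p.1 p.2).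
Proof.
move=> lamC; have mc := measurable_cumul lamC.
apply: measurable_fun_ifT; last exact: measurable_cst.
  apply: measurable_and.
    by apply: measurable_fun_ler; [exact: measurable_cst|exact: measurable_fst].
  by apply: measurable_fun_ler; [exact: measurable_fst|exact: measurable_snd].
apply: measurableT_comp; first exact: measurable_expR.
by apply: measurable_funB; apply: measurableT_comp.
Qed.

(** Discounting acts as killing at rate [alpha]: the chain jumps or is killed eventually, so the
    total mass is that present at time [s]. The rate [alpha + lam] is integrated exactly over
    [[s, s + n]], and the boundary term is at most [exp (- alpha)^n]. *)
Lemma integral_survival alpha lam C s : 0 < alpha -> bounded_rate lam C -> 0 <= s ->
  (\int[leb]_u ((survival lam s u)%:E * (expR (- alpha * u) * (alpha + lam u))%:E) =
   (expR (- alpha * s))%:E)%E.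
Proof.
move=> a0 lamC s0.
have kC := bounded_rateD (ltW a0) lamC.
set k := (fun u => alpha + lam u) in kC.
have [mk k0C] := kC.
have ck u : 0 <= u -> cumul k u = alpha * u + cumul lam u.
  by move=> u0; apply: (cumulD (ltW a0) lamC).
pose g u := k u * expR (- cumul k u).
have mg : measurable_fun setT g.
  apply: measurable_funM => //; apply: measurableT_comp; first exact: measurable_expR.
  by apply: measurable_funN; exact: measurable_cumul kC.
have g0 u : 0 <= g u by rewrite mulr_ge0//; have [] := k0C u.
transitivity ((expR (cumul lam s))%:E * \int[leb]_(u in `[s, +oo[) (g u)%:E)%E.
  rewrite -ge0_integralZl//; last 2 first.
    by apply/measurable_EFinP; exact: measurable_funTS.
    by move=> x _; rewrite lee_fin.
  rewrite [RHS]integral_mkcond; apply: eq_integral => u _.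
  rewrite patchE /survival s0/=; case: ifPn => su.
    rewrite mem_set/=; last by rewrite in_itv/= su.
    rewrite -!EFinM /g; congr EFin.
    rewrite ck ?(le_trans s0)// mulrA -expRD [RHS]mulrCA -expRD [RHS]mulrC.
    by congr (expR _ * _); ring.
  by rewrite mul0e memNset//= in_itv/= andbT; exact/negP.
have cv1 : (\int[leb]_(u in `[s, (s + n%:R)%R]) (g u)%:E)%E @[n --> \oo] -->
    (\int[leb]_(u in `[s, +oo[) (g u)%:E)%E.
  rewrite itv_bndy_bigcup_BRight; apply: ge0_nondecreasing_set_cvg_integral => //.
  - move=> n m nm; apply/subsetPset; apply: subset_itvl.
    by rewrite bnd_simp lerD2l ler_nat.
  - by move=> i; apply/measurable_EFinP; exact: measurable_funTS.
  - by move=> i x _; rewrite lee_fin.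
have cv2 : (\int[leb]_(u in `[s, (s + n%:R)%R]) (g u)%:E)%E @[n --> \oo] -->
    (expR (- cumul k s))%:E.
  rewrite (_ : (fun n => _) =
     (fun n => (expR (- cumul k s) - expR (- cumul k (s + n%:R)))%:E)); last first.
    apply/funext => n; rewrite -(Rintegral_rate_expR kC)//; last by rewrite lerDl.
    rewrite fineK//; apply: integrable_fin_num => //.
    apply: (@bounded_integrable_itv _ _ _ (alpha + C)) => // u _ _.
    have [k0 k1] := k0C u; rewrite ger0_norm ?g0// -[leRHS]mulr1 ler_pM// -expR0 ler_expR.
    by rewrite oppr_le0 (cumul_ge0 kC).
  apply: cvg_EFin; first by near=> n.
  rewrite -[X in _ --> X]subr0; apply: cvgB; first exact: cvg_cst.
  apply: (@squeeze_cvgr _ _ _ _ (fun=> 0) (fun n => expR (- alpha) ^+ n)).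
  - near=> n; rewrite expR_ge0/= -expRM_natl ler_expR ck ?addr_ge0//.
    have := cumul_ge0 lamC (s + n%:R); have : 0 <= alpha * s by rewrite mulr_ge0 ?(ltW a0).
    by rewrite mulrDr mulrN mulrC; lra.
  - exact: cvg_cst.
  - by apply: cvg_expr; rewrite ger0_norm ?expR_ge0// -expR0 ltr_expR oppr_lt0.
rewrite (cvg_unique _ cv1 cv2)// -EFinM -expRD ck//; congr (expR _)%:E; ring.
Unshelve. all: by end_near. Qed.

End CumulativeRate.

Local Open Scope ereal_scope.

(** * Countable sums *)

Section EsumCountable.
Context {R : realType} {S : countType}.
Implicit Types f : S -> \bar R.

(** Enumerating [S] by its codes, with value [0] at codes of no state, makes the theorems on series
    of nonnegative measurable functions applicable. *)
Lemma esumT_nneseries f : (forall k, 0 <= f k) ->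
  \esum_(k in [set: S]) f k = \sum_(n <oo) oapp f 0 (@pickle_inv S n).
Proof.
move=> f0; rewrite nneseries_esumT; last by move=> n; case: pickle_inv => /=.
pose B : set nat := (@choice.pickle S) @` [set: S].
have bijP : set_bij [set: S] B (@choice.pickle S).
  by apply: inj_bij => x y _ _ /(pcan_inj (@choice.pickleK S)).
rewrite [RHS](_ : _ = \esum_(n in B) oapp f 0 (@pickle_inv S n)).
  rewrite (reindex_esum _ _ _ _ bijP); apply: eq_esum => k _.
  by rewrite pickleK_inv.
rewrite [RHS]esum_mkcond; apply: eq_esum => n _; case: ifPn => // nB.
have := @pickle_invK S n; case: pickle_inv => [k /= kn|//].
by move: nB; rewrite notin_setE; case; exists k.
Qed.

Lemma measurable_esumT d (T : measurableType d) (f : S -> T -> \bar R) :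
  (forall k x, 0 <= f k x) -> (forall k, measurable_fun setT (f k)) ->
  measurable_fun setT (fun x => \esum_(k in [set: S]) f k x).
Proof.
move=> f0 mf.
rewrite (_ : (fun x => _) = fun x => \sum_(n <oo) (oapp f (cst 0) (@pickle_inv S n)) x).
  apply: (@ge0_emeasurable_sum _ _ _ setT _ xpredT) => n.
    by move=> x _ _; case: pickle_inv => /=.
  by move=> _; case: pickle_inv => [k|] /=; [exact: mf|exact: measurable_cst].
apply/funext => x; rewrite esumT_nneseries//.
by apply: eq_eseriesr => n _; case: pickle_inv.
Qed.

Lemma ge0_integral_esumT d (T : measurableType d)
    (mu : {measure set T -> \bar R}) (f : S -> T -> \bar R) :
  (forall k x, 0 <= f k x) -> (forall k, measurable_fun setT (f k)) ->
  \int[mu]_x (\esum_(k in [set: S]) f k x) =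
  \esum_(k in [set: S]) \int[mu]_x f k x.
Proof.
move=> f0 mf; rewrite esumT_nneseries; last by move=> k; exact: integral_ge0.
under eq_integral do rewrite esumT_nneseries//.
rewrite (eq_integral (fun x => \sum_(n <oo) (oapp f (cst 0) (@pickle_inv S n)) x)); last first.
  by move=> x _; apply: eq_eseriesr => n _; case: pickle_inv.
rewrite integral_nneseries//=.
- apply: eq_eseriesr => n _; case: pickle_inv => //=; exact: integral0.
- by move=> n; case: pickle_inv => [k|] /=; [exact: mf|exact: measurable_cst].
- by move=> n x _; case: pickle_inv => /=.
Qed.

End EsumCountable.

Lemma esum_nat_recl {R : realType} (f : nat -> \bar R) : (forall n, 0 <= f n) ->
  \esum_(n in [set: nat]) f n = f 0%N + \esum_(n in [set: nat]) f n.+1.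
Proof.
move=> f0; rewrite -!nneseries_esumT// nneseries_recl//; congr (_ + _).
by rewrite -nneseries_addn//; apply: eq_eseriesr => n _; rewrite addn1.
Qed.

Lemma esum_trunc {R : realType} (f : nat -> \bar R) N : (forall n, 0 <= f n) ->
  \esum_(n in [set: nat]) (if (n < N)%N then f n else 0) = \sum_(n < N) f n.
Proof.
elim: N f => [|N IH] f f0; first by rewrite big_ord0 esum1.
rewrite esum_nat_recl/=; last by move=> n; case: ifP.
by rewrite (IH (fun n => f n.+1))// big_ord_recl.
Qed.

Lemma esum_nat_le {R : realType} (f : nat -> \bar R) (x : \bar R) :
  (forall n, 0 <= f n) -> (forall N, \sum_(n < N) f n <= x) ->
  \esum_(n in [set: nat]) f n <= x.
Proof.
move=> f0 fx; rewrite -nneseries_esumT//.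
apply: lime_le; first by apply: is_cvg_nneseries => n _.
by apply: nearW => N; rewrite big_mkord; exact: fx.
Qed.

Lemma esum_nat_ge {R : realType} (f : nat -> \bar R) N : (forall n, 0 <= f n) ->
  \sum_(n < N) f n <= \esum_(n in [set: nat]) f n.
Proof.
by move=> f0; rewrite -esum_trunc//; apply: le_esum => n _; case: ifP.
Qed.

Section EsumChoice.
Context {R : realType} {T : choiceType}.
Implicit Types f g : T -> \bar R.

Lemma esumT_ge f k : (forall k, 0 <= f k) -> f k <= \esum_(j in [set: T]) f j.
Proof.
move=> f0; apply: esum_ge; exists [set k]; first by split.
by rewrite fsbig_set1.
Qed.

Lemma esum_eq0 f : (forall k, 0 <= f k) ->
  \esum_(j in [set: T]) f j = 0 -> forall k, f k = 0.
Proof.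
move=> f0 s0 k; apply/eqP; rewrite eq_le f0 andbT -s0; exact: esumT_ge.
Qed.

Lemma exchange_esumT (U : choiceType) (a : T -> U -> \bar R) :
  (forall i j, 0 <= a i j) ->
  \esum_(i in [set: T]) \esum_(j in [set: U]) a i j =
  \esum_(j in [set: U]) \esum_(i in [set: T]) a i j.
Proof.
move=> a0; rewrite !esum_esum//.
have bijP : set_bij ([set: U] `*`` (fun=> [set: T])) ([set: T] `*`` (fun=> [set: U]))
   (fun p : U * T => (p.2, p.1)).
  split => [//|[x y] [x' y'] _ _ /= [-> ->]//|[x y] _]; by exists (y, x).
by rewrite (reindex_esum _ _ _ _ bijP).
Qed.

(** The factor may be [+oo], as values and costs may be infinite. One inequality is checked on
    finite subsets; the other uses the factor [x^-1] when [x] is finite and positive, and a single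
    nonzero term when [x = +oo]. *)
Lemma esumZl f x : 0 <= x -> (forall k, 0 <= f k) ->
  \esum_(k in [set: T]) (x * f k) = x * \esum_(k in [set: T]) f k.
Proof.
move=> x0 f0.
have le1 y g : 0 <= y -> (forall k, 0 <= g k) ->
    \esum_(k in [set: T]) (y * g k) <= y * \esum_(k in [set: T]) g k.
  move=> y0 g0; apply: ge_ereal_sup => _ [X [finX _]] <-.
  rewrite fsbig_finite//= -ge0_sume_distrr; last by move=> ? _.
  apply: lee_wpmul2l => //; apply: esum_ge; exists X; first by split.
  by rewrite fsbig_finite.
apply/eqP; rewrite eq_le le1//=.
have [->|xN0] := eqVneq x 0.
  by rewrite mul0e esum_ge0// => k _; rewrite mul0e.
case: x x0 xN0 => [x| |//] x0 xN0.
  have xgt0 : (0 < x)%R by rewrite lt_neqAle eq_sym -eqe xN0 -lee_fin.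
  rewrite -lee_pdivlMl//; apply: le_trans (le1 _ _ _ _).
  - by apply: le_esum => k _; rewrite muleA -EFinM mulVf ?gt_eqF// mul1e.
  - by rewrite lee_fin invr_ge0 ltW.
  - by move=> k; apply: mule_ge0.
have [s0|sN0] := eqVneq (\esum_(k in [set: T]) f k) 0.
  by rewrite s0 mule0 esum_ge0// => k _; rewrite mule_ge0.
have [k fk] : exists k, f k != 0.
  apply: contrapT => /forallNP h; move/eqP: sN0; apply.
  by apply: esum1 => k _; apply/eqP; move: (h k) => /negP; rewrite negbK.
rewrite (@le_trans _ _ (+oo * f k))//; last first.
  by apply: (@esumT_ge (fun k => +oo * f k)) => j; exact: mule_ge0.
by rewrite [leRHS]gt0_mulye ?leey// lt_neqAle eq_sym fk f0.
Qed.

Lemma esumZr f x : 0 <= x -> (forall k, 0 <= f k) ->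
  \esum_(k in [set: T]) (f k * x) = (\esum_(k in [set: T]) f k) * x.
Proof.
by move=> x0 f0; under eq_esum do rewrite muleC; rewrite esumZl// muleC.
Qed.

Lemma esum_bump (x : \bar R) (i : T) : 0 <= x ->
  \esum_(k in [set: T]) (if k == i then x else 0) = x.
Proof.
move=> x0; rewrite -[RHS](@esum_set1 _ _ i (fun=> x))// [RHS]esum_mkcond.
apply: eq_esum => k _; have [->|/eqP ki] := eqVneq k i.
  by rewrite mem_set.
by rewrite memNset.
Qed.

End EsumChoice.

(** * The cost of a minimal Feller chain *)

Section FellerChain.
Context {R : realType} {S : countType}.
Local Notation leb := (@lebesgue_measure R).
Variables (lam : S -> R -> R) (qo : S -> S -> R -> R) (cc : S -> R -> R).
Variables (C : S -> R) (alpha : R).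
Hypothesis lamC : forall i, bounded_rate (lam i) (C i).
Hypothesis qo0 : forall i k u, (0 <= qo i k u)%R.
Hypothesis mqo : forall i k, measurable_fun setT (qo i k).
Hypothesis cc0 : forall i u, (0 <= cc i u)%R.
Hypothesis mcc : forall i, measurable_fun setT (cc i).
Hypothesis alpha0 : (0 < alpha)%R.

Let surv i s u : \bar R := (survival (lam i) s u)%:E.

Let surv0 i s u : 0 <= surv i s u.
Proof. by rewrite lee_fin survival_ge0. Qed.

Let msurv d (T : measurableType d) i (f g : T -> R) :
  measurable_fun setT f -> measurable_fun setT g ->
  measurable_fun setT (fun x => surv i (f x) (g x)).
Proof.
move=> mf mg; apply/measurable_EFinP.
apply: (measurableT_comp (measurable_survival (lamC i)) (measurable_fun_pair mf mg)).
Qed.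

Let surv_lt i s u : (u < s)%R -> surv i s u = 0.
Proof. by move=> us; rewrite /surv /survival [(s <= u)%R]leNgt us andbF. Qed.

(* [Pn] as a jointly measurable function of [(s, t)], see [Pn_njump];
   it vanishes unless [0 <= s <= t]. *)
Fixpoint njump (n : nat) (i j : S) (p : R * R) : \bar R :=
  match n with
  | 0 => if i == j then surv i p.1 p.2 else 0
  | m.+1 => \int[leb]_u (surv i p.1 u *
      \esum_(k in [set: S]) ((qo i k u)%:E * njump m k j (u, p.2)))
  end.

Lemma njump_ge0 n i j p : 0 <= njump n i j p.
Proof.
elim: n i p => [|n IH] i p /=; first by case: ifP.
apply: integral_ge0 => u _; rewrite mule_ge0// esum_ge0// => k _.
by rewrite mule_ge0// lee_fin.
Qed.

Lemma njump_lt n i j s t : (t < s)%R -> njump n i j (s, t) = 0.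
Proof.
elim: n i s => [|n IH] i s ts /=; first by case: ifP => // _; exact: surv_lt.
apply: integral0_eq => u _; have [us|su] := ltP u s.
  by rewrite surv_lt// mul0e.
rewrite esum1 ?mule0// => k _.
by rewrite IH ?mule0//; exact: lt_le_trans ts su.
Qed.

(** Joint measurability in both times is what the later exchanges of integrals require. Because the
    jump time ranges over the whole line, the induction step is the measurability part of Tonelli's
    theorem for a function of [((s, t), u)]. *)
Lemma measurable_njump n i j : measurable_fun setT (njump n i j).
Proof.
elim: n i => [|n IH] i /=.
  case: (i == j); last exact: measurable_cst.
  by apply: msurv; [exact: measurable_fst|exact: measurable_snd].
pose h (x : (R * R) * R) : \bar R := surv i x.1.1 x.2 *
  \esum_(k in [set: S]) ((qo i k x.2)%:E * njump n k j (x.2, x.1.2)).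
have mh : measurable_fun setT h.
  apply: emeasurable_funM.
    apply: msurv; last exact: measurable_snd.
    exact: measurableT_comp measurable_fst measurable_fst.
  apply: measurable_esumT => [k x|k].
    by rewrite mule_ge0 ?njump_ge0// lee_fin.
  apply: emeasurable_funM.
    apply/measurable_EFinP; exact: measurableT_comp (mqo i k) measurable_snd.
  apply: (measurableT_comp (IH k)).
  apply: measurable_fun_pair; first exact: measurable_snd.
  exact: measurableT_comp measurable_snd measurable_fst.
have := @measurable_fun_fubini_tonelli_F _ _ _ _ R leb h mh; apply => x.
rewrite /h mule_ge0// esum_ge0// => k _.
by rewrite mule_ge0 ?njump_ge0// lee_fin.
Qed.

Let mpair (s : R) : measurable_fun setT (fun u : R => (s, u)).
Proof. by apply: measurable_fun_pair => //; exact: measurable_cst. Qed.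

Let mpair2 (s : R) : measurable_fun setT (fun u : R => (u, s)).
Proof. by apply: measurable_fun_pair => //; exact: measurable_cst. Qed.

(** Expected cost rate at time [p.2] of the chain started in [i] at time [p.1], on the event of
    exactly [n] jumps in between. *)
Definition cost_njump n i (p : R * R) : \bar R :=
  \esum_(j in [set: S]) (njump n i j p * (cc j p.2)%:E).

Let qo0E i k u : 0 <= (qo i k u)%:E. Proof. by rewrite lee_fin. Qed.
Let cc0E i u : 0 <= (cc i u)%:E. Proof. by rewrite lee_fin. Qed.
Hint Resolve surv0 qo0E cc0E njump_ge0 : core.

Lemma cost_njump_ge0 n i p : 0 <= cost_njump n i p.
Proof. by apply: esum_ge0 => j _; exact: mule_ge0. Qed.
Hint Resolve cost_njump_ge0 : core.

Lemma measurable_cost_njump n i : measurable_fun setT (cost_njump n i).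
Proof.
apply: measurable_esumT => [j p|j]; first exact: mule_ge0.
apply: emeasurable_funM; first exact: measurable_njump.
by apply/measurable_EFinP; exact: measurableT_comp (mcc j) measurable_snd.
Qed.

Lemma cost_njump0 i p : cost_njump 0 i p = surv i p.1 p.2 * (cc i p.2)%:E.
Proof.
rewrite /cost_njump /= -[RHS](@esum_bump _ _ _ i) ?mule_ge0//.
apply: eq_esum => j _; rewrite eq_sym; case: eqVneq => [->//|_].
by rewrite mul0e.
Qed.

Lemma cost_njumpS n i p : cost_njump n.+1 i p =
  \int[leb]_u (surv i p.1 u *
      \esum_(k in [set: S]) ((qo i k u)%:E * cost_njump n k (u, p.2))).
Proof.
have mk j : measurable_fun setT (fun u =>
    \esum_(k in [set: S]) ((qo i k u)%:E * njump n k j (u, p.2))).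
  apply: measurable_esumT => [k u|k]; first exact: mule_ge0.
  apply: emeasurable_funM; first exact/measurable_EFinP.
  exact: measurableT_comp (measurable_njump n k j) (mpair2 _).
have k0 j u : 0 <= \esum_(k in [set: S]) ((qo i k u)%:E * njump n k j (u, p.2)).
  by apply: esum_ge0 => k _; exact: mule_ge0.
have ms : measurable_fun setT (surv i p.1).
  by apply: msurv => //; exact: measurable_cst.
rewrite /cost_njump /=.
under eq_esum => j _.
  rewrite muleC -ge0_integralZl//; first over.
    exact: (emeasurable_funM ms (mk j)).
  by move=> u _; exact: mule_ge0.
rewrite -ge0_integral_esumT; last 2 first.
- by move=> j u; rewrite !mule_ge0.
- move=> j; apply: emeasurable_funM; first exact: measurable_cst.
  exact: (emeasurable_funM ms (mk j)).
apply: eq_integral => u _.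
under eq_esum => j _ do rewrite muleCA.
rewrite esumZl//; last by move=> j; exact: mule_ge0.
congr (_ * _).
under eq_esum => j _.
  rewrite -esumZl//; first over.
  by move=> k; exact: mule_ge0.
rewrite exchange_esumT; last by move=> j k; rewrite !mule_ge0.
apply: eq_esum => k _.
rewrite -esumZl//; last by move=> j; exact: mule_ge0.
by apply: eq_esum => j _; rewrite muleCA [X in _ * X = _]muleC.
Qed.

(** Costs are discounted to time [0], not to the starting time [s]; hence the factor
    [exp (- alpha s)] in the comparison lemmas below. *)
Definition dcost_njump n i (s : R) : \bar R :=
  \int[leb]_t ((expR (- alpha * t))%:E * cost_njump n i (s, t)).

Let exp0 (t : R) : 0 <= (expR (- alpha * t))%:E. Proof. by rewrite lee_fin expR_ge0. Qed.
Let mexp : measurable_fun setT (fun t : R => (expR (- alpha * t))%:E).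
Proof.
apply/measurable_EFinP; apply: measurableT_comp; first exact: measurable_expR.
by apply: measurable_funM => //; exact: measurable_cst.
Qed.
Hint Resolve exp0 : core.

Lemma dcost_njump_ge0 n i s : 0 <= dcost_njump n i s.
Proof. by apply: integral_ge0 => t _; exact: mule_ge0. Qed.
Hint Resolve dcost_njump_ge0 : core.

Lemma measurable_dcost_njump n i : measurable_fun setT (dcost_njump n i).
Proof.
pose h (x : R * R) : \bar R := (expR (- alpha * x.2))%:E * cost_njump n i x.
rewrite (_ : dcost_njump n i = fubini_F leb h); last first.
  by apply/funext => s.
apply: measurable_fun_fubini_tonelli_F => [|x]; last exact: mule_ge0.
apply: emeasurable_funM; last exact: measurable_cost_njump.
exact: measurableT_comp mexp measurable_snd.
Qed.

Lemma dcost_njump0 i s : dcost_njump 0 i s =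
  \int[leb]_u (surv i s u * (expR (- alpha * u) * cc i u)%:E).
Proof.
by apply: eq_integral => u _; rewrite cost_njump0/= muleCA EFinM.
Qed.

Lemma dcost_njumpS n i s : dcost_njump n.+1 i s =
  \int[leb]_u (surv i s u *
     \esum_(k in [set: S]) ((qo i k u)%:E * dcost_njump n k u)).
Proof.
have ms : measurable_fun setT (surv i s).
  by apply: msurv => //; exact: measurable_cst.
have mk : measurable_fun setT (fun x : R * R =>
    \esum_(k in [set: S]) ((qo i k x.2)%:E * cost_njump n k (x.2, x.1))).
  apply: measurable_esumT => [k u|k]; first exact: mule_ge0.
  apply: emeasurable_funM.
    by apply/measurable_EFinP; exact: measurableT_comp (mqo i k) measurable_snd.
  apply: measurableT_comp (measurable_cost_njump n k) _.
  by apply: measurable_fun_pair; [exact: measurable_snd|exact: measurable_fst].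
have k0 t u : 0 <= \esum_(k in [set: S]) ((qo i k u)%:E * cost_njump n k (u, t)).
  by apply: esum_ge0 => k _; exact: mule_ge0.
pose h (x : R * R) : \bar R := (expR (- alpha * x.1))%:E * (surv i s x.2 *
    \esum_(k in [set: S]) ((qo i k x.2)%:E * cost_njump n k (x.2, x.1))).
have mh : measurable_fun setT h.
  apply: emeasurable_funM; first exact: measurableT_comp mexp measurable_fst.
  by apply: emeasurable_funM => //; exact: measurableT_comp ms measurable_snd.
have h0 x : 0 <= h x by rewrite !mule_ge0.
transitivity (\int[leb]_t \int[leb]_u h (t, u)).
  apply: eq_integral => t _; rewrite cost_njumpS -ge0_integralZl//; last first.
    by move=> u _; exact: mule_ge0.
  apply: emeasurable_funM => //.
  exact: (measurableT_comp mk (mpair t)).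
rewrite fubini_tonelli//; apply: eq_integral => u _; rewrite /h/=.
transitivity (\int[leb]_t (surv i s u * \esum_(k in [set: S])
   ((qo i k u)%:E * ((expR (- alpha * t))%:E * cost_njump n k (u, t))))).
  apply: eq_integral => t _; rewrite muleCA; congr (_ * _).
  rewrite -esumZl//; last by move=> k; exact: mule_ge0.
  by apply: eq_esum => k _; rewrite muleCA.
have mkt k : measurable_fun setT (fun t => (expR (- alpha * t))%:E * cost_njump n k (u, t)).
  apply: emeasurable_funM => //.
  exact: measurableT_comp (measurable_cost_njump n k) (mpair u).
rewrite ge0_integralZl//; last 2 first.
- apply: measurable_esumT => [k t|k]; first by rewrite !mule_ge0.
  exact: (emeasurable_funM (measurable_cst _) (mkt k)).
- by move=> t _; apply: esum_ge0 => k _; rewrite !mule_ge0.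
congr (_ * _); rewrite ge0_integral_esumT; last 2 first.
- by move=> k t; rewrite !mule_ge0.
- by move=> k; exact: (emeasurable_funM (measurable_cst _) (mkt k)).
apply: eq_esum => k _; apply: ge0_integralZl.
- exact: measurableT.
- exact: mkt.
- by move=> t _; exact: mule_ge0.
- by [].
Qed.

Definition dcost i s := \esum_(n in [set: nat]) dcost_njump n i s.

Lemma dcost_ge0 i s : 0 <= dcost i s.
Proof. exact: esum_ge0. Qed.
Hint Resolve dcost_ge0 : core.

Lemma measurable_dcost i : measurable_fun setT (dcost i).
Proof. by apply: measurable_esumT => // n; exact: measurable_dcost_njump. Qed.

(** Stated for an arbitrary family [x] so that it serves both the full sum over the number of jumps
    and its truncations. *)
Lemma first_jump_esum (x : nat -> S -> R -> \bar R) i s :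
  (forall n k u, 0 <= x n k u) -> (forall n k, measurable_fun setT (x n k)) ->
  \int[leb]_u (surv i s u * ((expR (- alpha * u) * cc i u)%:E +
     \esum_(k in [set: S]) ((qo i k u)%:E * \esum_(n in [set: nat]) x n k u))) =
  dcost_njump 0 i s + \esum_(n in [set: nat]) \int[leb]_u (surv i s u *
     \esum_(k in [set: S]) ((qo i k u)%:E * x n k u)).
Proof.
move=> x0 mx.
have ms : measurable_fun setT (surv i s).
  by apply: msurv => //; exact: measurable_cst.
have mc : measurable_fun setT (fun u => (expR (- alpha * u) * cc i u)%:E).
  apply/measurable_EFinP; apply: measurable_funM => //.
  by apply/measurable_EFinP; exact: mexp.
have c0 u : 0 <= (expR (- alpha * u) * cc i u)%:E.
  by rewrite lee_fin mulr_ge0 ?expR_ge0.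
have mV n k : measurable_fun setT (fun u => (qo i k u)%:E * x n k u).
  by apply: emeasurable_funM; [exact/measurable_EFinP|exact: mx].
have mW n : measurable_fun setT
    (fun u => \esum_(k in [set: S]) ((qo i k u)%:E * x n k u)).
  by apply: measurable_esumT => [k u|k]; [exact: mule_ge0|exact: mV].
have W0 n u : 0 <= \esum_(k in [set: S]) ((qo i k u)%:E * x n k u).
  by apply: esum_ge0 => k _; exact: mule_ge0.
rewrite dcost_njump0 -ge0_integral_esumT; last 2 first.
- by move=> n u; exact: mule_ge0.
- by move=> n; exact: (emeasurable_funM ms (mW n)).
rewrite -ge0_integralD//; last 4 first.
- by move=> u _; exact: mule_ge0.
- exact: (emeasurable_funM ms mc).
- by move=> u _; apply: esum_ge0 => n _; exact: mule_ge0.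
- apply: measurable_esumT => [n u|n]; first exact: mule_ge0.
  exact: (emeasurable_funM ms (mW n)).
apply: eq_integral => u _; rewrite esumZl// -ge0_muleDr//; last first.
  by apply: esum_ge0 => n _.
congr (_ * (_ + _)); rewrite exchange_esumT; last by move=> n k; exact: mule_ge0.
by apply: eq_esum => k _; rewrite esumZl.
Qed.

Lemma dcostE i s : dcost i s =
  \int[leb]_u (surv i s u * ((expR (- alpha * u) * cc i u)%:E +
     \esum_(k in [set: S]) ((qo i k u)%:E * dcost k u))).
Proof.
rewrite first_jump_esum//; last exact: measurable_dcost_njump.
have /= E := esum_nat_recl (fun n => dcost_njump_ge0 n i s).
rewrite -[dcost i s]/(\esum_(n in [set: nat]) dcost_njump n i s) E.
apply: (congr1 (adde (dcost_njump 0 i s))).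
apply: eq_esum => n _.
exact: dcost_njumpS.
Qed.

Lemma dcost_sumS N i s : \sum_(n < N.+1) dcost_njump n i s =
  \int[leb]_u (surv i s u * ((expR (- alpha * u) * cc i u)%:E +
     \esum_(k in [set: S]) ((qo i k u)%:E * \sum_(n < N) dcost_njump n k u))).
Proof.
pose x n k u := if (n < N)%N then dcost_njump n k u else 0.
transitivity (\int[leb]_u (surv i s u * ((expR (- alpha * u) * cc i u)%:E +
     \esum_(k in [set: S]) ((qo i k u)%:E * \esum_(n in [set: nat]) x n k u)))).
  rewrite first_jump_esum//; last 2 first.
  - by move=> n k u; rewrite /x; case: ifP.
  - move=> n k; rewrite /x; case: (n < N)%N; last exact: measurable_cst.
    exact: measurable_dcost_njump.
  rewrite big_ord_recl.
  apply: (congr1 (adde (dcost_njump 0 i s))).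
  rewrite -(@esum_trunc _ (fun n => dcost_njump n.+1 i s))//.
  apply: eq_esum => n _; rewrite /x; case: ifP => _.
    exact: dcost_njumpS.
  rewrite integral0_eq// => u _; rewrite esum1 ?mule0// => k _.
  by rewrite mule0.
apply: eq_integral => u _; congr (_ * (_ + _)).
by apply: eq_esum => k _; rewrite esum_trunc.
Qed.

Let mdcc i : measurable_fun setT (fun u => (expR (- alpha * u) * cc i u)%:E).
Proof.
apply/measurable_EFinP; apply: measurable_funM; last exact: mcc.
by apply/measurable_EFinP; exact: mexp.
Qed.

Let lam0 i u : (0 <= lam i u)%R. Proof. by have [_ /(_ u)[]] := lamC i. Qed.

Let rate i (u : R) : \bar R := (expR (- alpha * u) * (alpha + lam i u))%:E.

Let rate0 i u : 0 <= rate i u.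
Proof. by rewrite lee_fin mulr_ge0 ?expR_ge0// addr_ge0// ltW. Qed.

Hint Resolve rate0 : core.

Let mrate i : measurable_fun setT (rate i).
Proof.
apply/measurable_EFinP; apply: measurable_funM.
  by apply/measurable_EFinP; exact: mexp.
by apply: measurable_funD; [exact: measurable_cst|have [] := lamC i].
Qed.

(** Writes a bound [exp (- alpha s) y] as an integral against the same survival kernel as the
    first-jump recursions, so that comparing the two reduces to comparing integrands. *)
Let integral_rateM i s (y : \bar R) : (0 <= s)%R -> 0 <= y ->
  \int[leb]_u (surv i s u * (rate i u * y)) = (expR (- alpha * s))%:E * y.
Proof.
move=> s0 y0; rewrite -(integral_survival alpha0 (lamC i) s0).
rewrite muleC -ge0_integralZl//; last 2 first.
- apply: emeasurable_funM (mrate i).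
  by apply: msurv => //; exact: measurable_cst.
- by move=> u _; exact: (mule_ge0 (surv0 i s u) (rate0 i u)).
by apply: eq_integral => u _; rewrite muleA muleC.
Qed.

(** Induction on the number of jumps taken into account: the supersolution inequality at the first
    jump time absorbs both the running cost and the bound on the continuation. *)
Lemma dcost_le (v : S -> \bar R) : (forall k, 0 <= v k) ->
  (forall i u, (cc i u)%:E + \esum_(k in [set: S]) ((qo i k u)%:E * v k)
      <= (alpha + lam i u)%:E * v i) ->
  forall i s, dcost i s <= (expR (- alpha * s))%:E * v i.
Proof.
move=> v0 hv i s; apply: esum_nat_le => // N.
elim: N i s => [|N IH] i s; first by rewrite big_ord0 mule_ge0.
have ms : measurable_fun setT (surv i s).
  by apply: msurv => //; exact: measurable_cst.
(* For [s < 0] the survival function is [0] by convention, and so is the cost. *)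
rewrite dcost_sumS; have [s0|s0] := ltP s 0%R.
  rewrite integral0_eq; first exact: mule_ge0.
  by move=> u _; rewrite /surv /survival [(0 <= s)%R]leNgt s0 mul0e.
rewrite -(@integral_rateM i)//; apply: ge0_le_integral => //.
- move=> u _; rewrite mule_ge0// adde_ge0//.
    by rewrite lee_fin mulr_ge0 ?expR_ge0.
  by apply: esum_ge0 => k _; rewrite mule_ge0// sume_ge0.
- apply: emeasurable_funM => //; apply: emeasurable_funD.
    exact: mdcc.
  apply: measurable_esumT => [k u|k]; first by rewrite mule_ge0// sume_ge0.
  apply: emeasurable_funM; first by apply/measurable_EFinP; exact: mqo.
  by apply: emeasurable_sum => n; exact: measurable_dcost_njump.
- exact: (emeasurable_funM ms (emeasurable_funM (mrate i) (measurable_cst _))).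
- move=> u _; apply: lee_wpmul2l => //.
  apply: (@le_trans _ _ ((expR (- alpha * u))%:E * ((cc i u)%:E +
      \esum_(k in [set: S]) ((qo i k u)%:E * v k)))).
    rewrite ge0_muleDr//; last by apply: esum_ge0 => k _; exact: mule_ge0.
    rewrite EFinM; apply: leeD => //.
    rewrite -esumZl//; last by move=> k; exact: mule_ge0.
    by apply: le_esum => k _; rewrite muleCA; exact: lee_wpmul2l.
  by rewrite /rate EFinM -muleA; exact: lee_wpmul2l.
Qed.

(** A single first-jump decomposition suffices, because [v] is assumed to bound the continuation
    cost from every later time. *)
Lemma dcost_ge (v : S -> \bar R) i (x : \bar R) : (forall k, 0 <= v k) -> 0 <= x ->
  (forall k u, (0 <= u)%R -> (expR (- alpha * u))%:E * v k <= dcost k u) ->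
  (forall u, (alpha + lam i u)%:E * x <=
     (cc i u)%:E + \esum_(k in [set: S]) ((qo i k u)%:E * v k)) ->
  forall s, (0 <= s)%R -> (expR (- alpha * s))%:E * x <= dcost i s.
Proof.
move=> v0 x0 hv hx s s0; rewrite dcostE -(@integral_rateM i)//.
have ms : measurable_fun setT (surv i s).
  by apply: msurv => //; exact: measurable_cst.
apply: ge0_le_integral => //.
- by move=> u _; rewrite !mule_ge0.
- exact: (emeasurable_funM ms (emeasurable_funM (mrate i) (measurable_cst _))).
- apply: emeasurable_funM => //; apply: emeasurable_funD.
    exact: mdcc.
  apply: measurable_esumT => [k u|k]; first by rewrite mule_ge0.
  apply: emeasurable_funM; first by apply/measurable_EFinP; exact: mqo.
  exact: measurable_dcost.
- move=> u _; have [us|su] := ltP u s.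
    by rewrite surv_lt// !mul0e.
  apply: lee_wpmul2l => //.
  apply: (@le_trans _ _ ((expR (- alpha * u))%:E * ((cc i u)%:E +
      \esum_(k in [set: S]) ((qo i k u)%:E * v k)))).
    by rewrite /rate EFinM -muleA; exact: lee_wpmul2l.
  rewrite ge0_muleDr//; last by apply: esum_ge0 => k _; exact: mule_ge0.
  rewrite EFinM; apply: leeD => //.
  rewrite -esumZl//; last by move=> k; exact: mule_ge0.
  apply: le_esum => k _; rewrite muleCA; apply: lee_wpmul2l => //.
  by apply: hv; exact: le_trans su.
Qed.

End FellerChain.

(** * The discounted problem *)

Lemma ex_argmin_seq (T : eqType) (R : realType) (F : T -> \bar R) (s : seq T) :
  s != [::] -> exists2 a, a \in s & forall b, b \in s -> F a <= F b.
Proof.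
elim: s => // x [|y s] IH _.
  by exists x; rewrite ?mem_head// => b; rewrite inE => /eqP ->.
have [//|a ain amin] := IH.
have [Fxa|Fax] := leP (F x) (F a).
  exists x; rewrite ?mem_head// => b; rewrite inE => /predU1P[->//|/amin].
  exact: le_trans.
exists a; first by rewrite inE ain orbT.
by move=> b; rewrite inE => /predU1P[->|/amin//]; exact: ltW.
Qed.

Section DiscountedCost.
Context {R : realType} {S : countType} {Act : choiceType}.
Variables (A : S -> {fset Act}) (q : S -> Act -> S -> R) (c : S -> Act -> R).
Hypothesis hA : forall i, A i != fset0.
Hypothesis hq_nonneg : forall i a j, a \in A i -> j != i -> (0 <= q i a j)%R.
Hypothesis hq_cons : forall i a, a \in A i -> sumS (fun j => q i a j) = 0.
Hypothesis hc : forall i a, a \in A i -> (0 <= c i a)%R.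

Definition qoff i a k : R := if k == i then 0%R else q i a k.

Lemma qoff_ge0 i a k : a \in A i -> (0 <= qoff i a k)%R.
Proof. by move=> ai; rewrite /qoff; case: eqVneq => // ki; exact: hq_nonneg. Qed.

(** In [sumS] only the diagonal term can be negative, so the negative part is finite. *)
Lemma conservative i a : a \in A i ->
  (q i a i <= 0)%R /\ \esum_(k in [set: S]) (qoff i a k)%:E = (- q i a i)%:E.
Proof.
move=> ai; have := hq_cons ai; rewrite /sumS.
have -> : \esum_(j in [set: S]) (Num.max (- q i a j) 0)%:E = (Num.max (- q i a i) 0)%:E.
  rewrite -[RHS](@esum_bump _ _ _ i); last by rewrite lee_fin le_max lexx orbT.
  apply: eq_esum => k _; case: eqVneq => [->//|ki].
  by rewrite max_r// oppr_le0 hq_nonneg.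
have -> : \esum_(j in [set: S]) (Num.max (q i a j) 0)%:E =
    \esum_(j in [set: S]) (qoff i a j)%:E + (Num.max (q i a i) 0)%:E.
  rewrite -[X in _ + X](@esum_bump _ _ _ i); last by rewrite lee_fin le_max lexx orbT.
  rewrite -esumD; last 2 first.
  - by move=> k _; rewrite lee_fin qoff_ge0.
  - by move=> k _; case: ifP => // _; rewrite lee_fin le_max lexx orbT.
  apply: eq_esum => k _; rewrite /qoff; case: eqVneq => [->|ki].
    by rewrite add0e.
  by rewrite adde0 max_l// hq_nonneg.
have : 0 <= \esum_(j in [set: S]) (qoff i a j)%:E.
  by apply: esum_ge0 => k _; rewrite lee_fin qoff_ge0.
(* An infinite off-diagonal sum would make [sumS] equal to [+oo] instead of [0]. *)
case: (\esum_(j in _) _) => [x| |]//; rewrite lee_fin => x0.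
rewrite (_ : _ - _ = (x + Num.max (q i a i) 0 - Num.max (- q i a i) 0)%:E)// => -[].
case: (lerP (q i a i) 0) => qi.
  by rewrite max_l ?oppr_ge0// addr0 => /eqP; rewrite subr_eq0 => /eqP ->.
rewrite max_r ?oppr_le0 ?ltW// subr0 => h; exfalso; lra.
Qed.

(** * Randomized Markov policies as instances of the Feller chain *)

Section Policy.
Variable pi : R -> S -> Act -> R.
Hypothesis hpi : is_policy A pi.

Definition pol_off i k u : R := if k == i then 0%R else qpol A q pi u i k.
Definition pol_exit i u : R := qexit A q pi u i.
Definition pol_cost i u : R := (\sum_(a <- A i) pi u i a * c i a)%R.

Let pi0 t i a : (0 <= pi t i a)%R. Proof. by case: hpi. Qed.

Lemma policy_le1 t i a : a \in A i -> (pi t i a <= 1)%R.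
Proof.
move=> ai; have [_ [sum1 _]] := hpi; rewrite -(sum1 t i).
rewrite (big_rem a)//= lerDl sumr_ge0//.
Qed.

(** Finiteness of [A i] yields a bound uniform in time: each action probability is at most [1]. *)
Lemma bounded_pol_exit i :
  bounded_rate (pol_exit i) (\sum_(a <- A i) - q i a i)%R.
Proof.
have [_ [_ mpi]] := hpi; split.
  apply: measurable_funN; apply: measurable_sum => a.
  by apply: measurable_funM; [exact: measurable_cst|exact: mpi].
move=> t; rewrite /pol_exit /qexit /qpol -sumrN; split.
  rewrite big_seq sumr_ge0// => a ai; rewrite -mulNr mulr_ge0// oppr_ge0.
  by have [] := conservative ai.
rewrite big_seq [leRHS]big_seq ler_sum// => a ai.
rewrite -mulNr ler_piMr ?policy_le1// oppr_ge0.
by have [] := conservative ai.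
Qed.

Lemma pol_offE i k u : pol_off i k u = (\sum_(a <- A i) pi u i a * qoff i a k)%R.
Proof.
rewrite /pol_off /qpol /qoff; case: eqVneq => _.
  by rewrite big1// => a _; rewrite mulr0.
by apply: eq_bigr => a _; rewrite mulrC.
Qed.

Lemma pol_off_ge0 i k u : (0 <= pol_off i k u)%R.
Proof.
by rewrite pol_offE big_seq sumr_ge0// => a ai; rewrite mulr_ge0// qoff_ge0.
Qed.

Lemma measurable_pol_off i k : measurable_fun setT (pol_off i k).
Proof.
have [_ [_ mpi]] := hpi.
rewrite /pol_off; case: (k == i); first exact: measurable_cst.
apply: measurable_sum => a.
by apply: measurable_funM; [exact: measurable_cst|exact: mpi].
Qed.

Lemma pol_cost_ge0 i u : (0 <= pol_cost i u)%R.
Proof.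
by rewrite /pol_cost big_seq sumr_ge0// => a ai; rewrite mulr_ge0// hc.
Qed.

Lemma measurable_pol_cost i : measurable_fun setT (pol_cost i).
Proof.
have [_ [_ mpi]] := hpi; apply: measurable_sum => a.
by apply: measurable_funM; [exact: mpi|exact: measurable_cst].
Qed.

(** Extending the integral from [[s, t]] to the line adds nothing: survival vanishes for [u < s],
    and the remaining jumps have probability [0] for [u > t]. *)
Lemma Pn_njump n (s : R) i (t : R) j : (0 <= s)%R -> (s <= t)%R ->
  Pn A q pi n s i t j = njump pol_exit pol_off n i j (s, t).
Proof.
have surv i' (s' t' : R) : (0 <= s')%R -> (s' <= t')%R ->
    expeR (- \int[@leb R]_(v in `[s', t']) (qexit A q pi v i')%:E) =
    (survival (pol_exit i') s' t')%:E.
  move=> s0 st; rewrite /survival s0 st/= (integral_rate (bounded_pol_exit i'))//=.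
  by rewrite opprB.
elim: n s i => [|n IH] s i s0 st /=; first by case: ifP => // _; rewrite surv.
rewrite integral_mkcond; apply: eq_integral => u _; rewrite patchE.
case: ifPn => ui.
  move: ui; rewrite inE/= in_itv/= => /andP[su ut]; rewrite surv//; congr (_ * _).
  rewrite esum_mkcond; apply: eq_esum => k _; rewrite /pol_off.
  case: (eqVneq k i) => [->|ki].
    by rewrite memNset ?mul0e//= eqxx.
  by rewrite mem_set//= IH//; exact: le_trans su.
have [us|su] := ltP u s.
  by rewrite /survival [(s <= u)%R]leNgt us andbF mul0e.
have [ut|tu] := leP u t.
  by move: ui; rewrite notin_setE/= in_itv/= su ut.
by rewrite esum1 ?mule0// => k _; rewrite njump_lt ?mule0.
Qed.

Lemma Jdisc_dcost alpha i :
  Jdisc A q c alpha pi i = dcost pol_exit pol_off pol_cost alpha i 0%R.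
Proof.
have njge := njump_ge0 (qo := pol_off) pol_exit pol_off_ge0.
have c0 j t : 0 <= (pol_cost j t)%:E by rewrite lee_fin pol_cost_ge0.
have e0 t : 0 <= (expR (- alpha * t))%:E by rewrite lee_fin expR_ge0.
rewrite /dcost /dcost_njump -ge0_integral_esumT; last 2 first.
- move=> n t; apply: mule_ge0 => //; apply: esum_ge0 => j _.
  exact: mule_ge0.
- move=> n; apply: emeasurable_funM.
    apply/measurable_EFinP; apply: measurableT_comp; first exact: measurable_expR.
    by apply: measurable_funM => //; exact: measurable_cst.
  have mp : measurable_fun setT (fun t : R => (0%R : R, t)).
    by apply: measurable_fun_pair => //; exact: measurable_cst.
  apply: measurableT_comp mp.
  exact: (measurable_cost_njump bounded_pol_exit pol_off_ge0 measurable_pol_off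
    pol_cost_ge0 measurable_pol_cost).
rewrite /Jdisc [LHS]integral_mkcond; apply: eq_integral => t _; rewrite patchE.
rewrite esumZl//; last by move=> n; apply: esum_ge0 => j _; exact: mule_ge0.
case: ifPn => ti.
  move: ti; rewrite inE/= in_itv/= andbT => t0; congr (_ * _).
  rewrite /cost_njump exchange_esumT; last by move=> n j; exact: mule_ge0.
  apply: eq_esum => j _; rewrite esumZr//; congr (_ * _).
  by apply: eq_esum => n _; exact: Pn_njump.
have t0 : (t < 0)%R by move: ti; rewrite notin_setE/= in_itv/= andbT => /negP; rewrite -ltNge.
rewrite esum1 ?mule0// => n _; apply: esum1 => j _.
by rewrite njump_lt ?mul0e.
Qed.

(** Costs and rates of a policy are averages over actions, which lets a Bellman inequality valid for
    each action pass to any policy. The sums carry the condition [a \in A i] because signs are known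
    only there. *)
Lemma pol_avg (v : S -> \bar R) i u : (forall k, 0 <= v k) ->
  (pol_cost i u)%:E + \esum_(k in [set: S]) ((pol_off i k u)%:E * v k) =
  \sum_(a <- A i | a \in A i) (pi u i a)%:E *
    ((c i a)%:E + \esum_(k in [set: S]) ((qoff i a k)%:E * v k)).
Proof.
move=> v0.
have q0 a k : a \in A i -> 0 <= (qoff i a k)%:E by move=> ai; rewrite lee_fin qoff_ge0.
have p0 a : 0 <= (pi u i a)%:E by rewrite lee_fin.
under [RHS]eq_bigr => a ai.
  rewrite ge0_muleDr; first over.
    by rewrite lee_fin hc.
  by apply: esum_ge0 => k _; apply: mule_ge0 => //; exact: q0.
rewrite big_split/=; congr (_ + _).
  by rewrite /pol_cost -sumEFin [LHS]big_seq; apply: eq_bigr => a _; rewrite EFinM.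
transitivity (\esum_(k in [set: S])
    \sum_(a <- A i | a \in A i) (pi u i a)%:E * ((qoff i a k)%:E * v k)).
  apply: eq_esum => k _; rewrite pol_offE -sumEFin big_seq ge0_sume_distrl.
    by apply: eq_bigr => a _; rewrite EFinM muleA.
  by move=> a ai; rewrite lee_fin mulr_ge0// qoff_ge0.
rewrite esum_sum; last by move=> k a _ ai; rewrite !mule_ge0// q0.
apply: eq_bigr => a ai; rewrite esumZl// => k; apply: mule_ge0 => //; exact: q0.
Qed.

Lemma pol_avg_rate alpha i u (x : \bar R) : (0 < alpha)%R -> 0 <= x ->
  (alpha + pol_exit i u)%:E * x =
  \sum_(a <- A i | a \in A i) (pi u i a)%:E * ((alpha - q i a i)%:E * x).
Proof.
move=> a0 x0; have [_ [sum1 _]] := hpi.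
have -> : (alpha + pol_exit i u)%R =
    (\sum_(a <- A i) pi u i a * (alpha - q i a i))%R.
  under eq_bigr do rewrite mulrBr.
  rewrite sumrB -mulr_suml sum1 mul1r; congr (_ - _)%R.
  by rewrite /qpol; apply: eq_bigr => a _; rewrite mulrC.
rewrite -sumEFin big_seq ge0_sume_distrl.
  by apply: eq_bigr => a _; rewrite EFinM muleA.
move=> a ai; rewrite lee_fin mulr_ge0// subr_ge0 (le_trans _ (ltW a0))//.
by have [] := conservative ai.
Qed.

End Policy.

(** * Bellman inequalities for the discounted value *)

Section Discount.
Variable alpha : R.
Hypothesis alpha0 : (0 < alpha)%R.

Definition jump_sum i a (v : S -> \bar R) : \bar R :=
  \esum_(k in [set: S]) ((qoff i a k)%:E * v k).

Lemma jump_sum_ge0 i a v : a \in A i -> (forall k, 0 <= v k) -> 0 <= jump_sum i a v.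
Proof.
move=> ai v0; apply: esum_ge0 => k _; apply: mule_ge0 => //.
by rewrite lee_fin qoff_ge0.
Qed.

Lemma le_jump_sum i a v w : a \in A i -> (forall k, v k <= w k) ->
  jump_sum i a v <= jump_sum i a w.
Proof.
move=> ai vw; apply: le_esum => k _; apply: lee_wpmul2l => //.
by rewrite lee_fin qoff_ge0.
Qed.

(** The diagonal rate is moved to the right-hand side, so that both sides are nonnegative extended
    reals and [v] may be infinite. A witness action, rather than a minimum, directly provides the
    stationary policy in [Jstar_le]. *)
Definition supersolution (v : S -> \bar R) :=
  forall i, exists2 a, a \in A i &
    (c i a)%:E + jump_sum i a v <= (alpha - q i a i)%:E * v i.

Let rate_gt0 i a : a \in A i -> (0 < alpha - q i a i)%R.
Proof.
by move=> ai; rewrite subr_gt0 (le_lt_trans _ alpha0)//; have [] := conservative ai.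
Qed.

Lemma Jstar_ge0 i : 0 <= Jstar A q c alpha i.
Proof.
apply: le_ereal_inf_tmp => _ [pi hpi <-].
rewrite Jdisc_dcost//; apply: dcost_ge0 => *.
- exact: pol_off_ge0.
- exact: pol_cost_ge0.
Qed.

Lemma Jstar_le v i : (forall k, 0 <= v k) -> supersolution v ->
  Jstar A q c alpha i <= v i.
Proof.
move=> v0 /(_ _)/cid2-/all_sig[f fP].
have fA k : f k \in A k by have [] := fP k.
pose pi (t : R) k a : R := (a == f k)%:R.
have sumf k (F : Act -> R) : (\sum_(a <- A k) pi 0 k a * F a)%R = F (f k).
  rewrite (big_rem (f k))//= /pi eqxx mul1r big_seq big1 ?addr0// => a.
  rewrite mem_rem_uniq ?fset_uniq// inE => /andP[/negPf -> _]; exact: mul0r.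
have hpi : is_policy A pi.
  split; first by move=> *; rewrite ler0n.
  split; last by move=> *; exact: measurable_cst.
  move=> t k; rewrite -[RHS](sumf k (fun=> 1%R)).
  by apply: eq_bigr => a _; rewrite mulr1.
apply: (@le_trans _ _ (Jdisc A q c alpha pi i)); first by apply: ereal_inf_lbound; exists pi.
rewrite Jdisc_dcost//.
rewrite -[leRHS]mul1e (_ : 1 = (expR (- alpha * 0))%:E); last by rewrite mulr0 expR0.
apply: (dcost_le (bounded_pol_exit hpi) (pol_off_ge0 hpi) (measurable_pol_off hpi)
  (pol_cost_ge0 hpi) (measurable_pol_cost hpi)) => // k u.
have [_ hf] := fP k.
have -> : pol_cost pi k u = c k (f k) by exact: sumf.
have -> : pol_exit pi k u = (- q k (f k) k)%R.
  rewrite /pol_exit /qexit /qpol -[in RHS](sumf k (fun a => q k a k)).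
  by congr (- _)%R; apply: eq_bigr => a _; rewrite mulrC.
apply: le_trans hf; rewrite leeD2l//; apply: le_esum => l _.
by rewrite pol_offE (sumf k (fun a => qoff k a l)).
Qed.

(* The infimum over policies started at an arbitrary time is a supersolution,
   because the cost after the first jump is again of this form; minimality of
   [Jstar] then shows that the starting time is irrelevant. *)
Let Jany i : \bar R := ereal_inf [set x | exists pi s, [/\ is_policy A pi,
  (0 <= s)%R & x = (expR (alpha * s))%:E *
     dcost (pol_exit pi) (pol_off pi) (pol_cost pi) alpha i s]].

Let Jany_ge0 i : 0 <= Jany i.
Proof.
apply: le_ereal_inf_tmp => _ [pi [s [hpi s0 ->]]]; apply: mule_ge0.
  by rewrite lee_fin expR_ge0.
apply: dcost_ge0 => *; [exact: pol_off_ge0|exact: pol_cost_ge0].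
Qed.

(** [Q a] is the value of using [a] up to the first jump and paying [Jany] then. For any policy and
    starting time, [dcost_ge] with [v = Jany] bounds the cost below by the discounted minimum of
    [Q], since the policy averages over actions [b] with [Q a <= Q b]. *)
Let Jany_supersolution : supersolution Jany.
Proof.
move=> i.
pose Q a := (alpha - q i a i)^-1%:E * ((c i a)%:E + jump_sum i a Jany).
have ANil : (A i : seq Act) != [::].
  apply: contra (hA i) => /eqP h; apply/eqP/fsetP => a.
  by rewrite -[a \in A i]/(a \in (A i : seq Act)) h.
have [a ai amin] := ex_argmin_seq Q ANil.
exists a => //; rewrite -lee_pdivrMl ?rate_gt0//.
apply: le_ereal_inf_tmp => _ [pi [s [hpi s0 ->]]].
have Q0 : 0 <= Q a.
  apply: mule_ge0; first by rewrite lee_fin invr_ge0 ltW ?rate_gt0.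
  by apply: adde_ge0; [rewrite lee_fin hc|exact: jump_sum_ge0].
have key : (expR (- alpha * s))%:E * Q a <=
    dcost (pol_exit pi) (pol_off pi) (pol_cost pi) alpha i s.
  apply: (dcost_ge (bounded_pol_exit hpi) (pol_off_ge0 hpi) (measurable_pol_off hpi)
     (pol_cost_ge0 hpi) (measurable_pol_cost hpi) alpha0 Jany_ge0) => //.
    move=> k u u0; rewrite -(invrK (expR (- alpha * u))) lee_pdivrMl ?invr_gt0 ?expR_gt0//.
    apply: ereal_inf_lbound; exists pi, u; split => //.
    by rewrite mulNr expRN invrK.
  move=> u; rewrite pol_avg_rate// pol_avg//; apply: lee_sum => b bi.
  apply: lee_wpmul2l; first by rewrite lee_fin; have [] := hpi.
  by rewrite -lee_pdivlMl ?rate_gt0//; exact: amin.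
rewrite -/(Q a) -lee_pdivrMl ?expR_gt0//; apply: le_trans key.
by rewrite mulNr expRN.
Qed.

(** [Jstar <= Jany] by minimality, and [Jany <= Jstar] by starting at time [0]. *)
Lemma Jstar_supersolution : supersolution (Jstar A q c alpha).
Proof.
suff -> : Jstar A q c alpha = Jany by exact: Jany_supersolution.
apply/funext => i; apply/eqP; rewrite eq_le (Jstar_le _ Jany_ge0 Jany_supersolution)/=.
apply: le_ereal_inf_tmp => _ [pi hpi <-]; apply: ereal_inf_lbound.
by exists pi, 0%R; split => //; rewrite Jdisc_dcost// mulr0 expR0 mul1e.
Qed.

(** Lowering [Jstar] at the single state [i] to [Q], if [Q] is smaller, leaves a supersolution: [a]
    is a witness at [i], and elsewhere the old witness still works. Minimality then forces
    [Jstar i <= Q]. *)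
Lemma Jstar_bellman_le i a : a \in A i ->
  (alpha - q i a i)%:E * Jstar A q c alpha i <=
  (c i a)%:E + jump_sum i a (Jstar A q c alpha).
Proof.
move=> ai; set J := Jstar A q c alpha.
pose Q := (alpha - q i a i)^-1%:E * ((c i a)%:E + jump_sum i a J).
pose v k := if k == i then mine (J k) Q else J k.
have vJ k : v k <= J k by rewrite /v; case: ifP => // _; rewrite ge_min lexx.
have v0 k : 0 <= v k.
  rewrite /v; case: ifP => _; last exact: Jstar_ge0.
  rewrite le_min Jstar_ge0/= mule_ge0//.
    by rewrite lee_fin invr_ge0 ltW ?rate_gt0.
  by apply: adde_ge0; [rewrite lee_fin hc|apply: jump_sum_ge0 => //; exact: Jstar_ge0].
have supv : supersolution v.
  move=> k; have [b bk hb] := Jstar_supersolution k.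
  have hbv : (c k b)%:E + jump_sum k b v <= (alpha - q k b k)%:E * J k.
    by apply: le_trans hb; rewrite leeD2l// le_jump_sum.
  rewrite {2}/v; case: eqVneq => [ki|_]; last by exists b.
  subst k; have [_|_] := leP (J i) Q; first by exists b.
  exists a => //; rewrite muleA -EFinM divff ?gt_eqF ?rate_gt0// mul1e.
  by rewrite leeD2l// le_jump_sum.
rewrite -lee_pdivlMl ?rate_gt0//.
apply: le_trans (Jstar_le i v0 supv) _.
by rewrite /v eqxx ge_min lexx orbT.
Qed.

End Discount.
End DiscountedCost.

(** * Taboo potentials of the jump chain *)

Section TabooPotential.
Context {R : realType} {S : countType} {Act : choiceType}.
Variables (q : S -> Act -> S -> R) (e : S -> Act).
Local Notation qo l k := (qoff q l (e l) k).
Local Notation qex l := (qe q e l).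
Hypothesis qo0 : forall l k, (0 <= qo l k)%R.
Hypothesis sum_qo : forall l, \esum_(k in [set: S]) (qo l k)%:E = (qex l)%:E.
Variables (i : S) (G : set S).

Let qex0 l : (0 <= qex l)%R.
Proof. by rewrite -lee_fin -sum_qo; apply: esum_ge0 => k _; rewrite lee_fin. Qed.

Lemma pjumpE l k : pjump q e l k = (qo l k / qex l)%R.
Proof. by rewrite /pjump /qoff eq_sym; case: ifP => //; rewrite mul0r. Qed.

Let p l k : \bar R := (pjump q e l k)%:E.
Let p0 l k : 0 <= p l k.
Proof. by rewrite /p lee_fin pjumpE divr_ge0. Qed.
Let p0' l k : 0 <= (pjump q e l k)%:E. Proof. exact: p0. Qed.
Hint Resolve p0 p0' : core.

Let tau n l := taboo q e i G n l.

Lemma taboo_ge0 n l : 0 <= taboo q e i G n l.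
Proof.
elim: n l => [|n IH] l /=; first by case: ifP.
by case: ifP => // _; apply: esum_ge0 => k _; exact: mule_ge0.
Qed.
Hint Resolve taboo_ge0 : core.
Let tau0 n l : 0 <= tau n l. Proof. exact: taboo_ge0. Qed.
Hint Resolve tau0 : core.

Definition step_in (x : S -> \bar R) l : \bar R :=
  \esum_(k in [set: S]) (if k \in G then p l k * x k else 0).
Definition step_out (x : S -> \bar R) l : \bar R :=
  \esum_(k in [set: S]) (if k \in G then 0 else p l k * x k).
Definition tsum n (y : S -> \bar R) : \bar R :=
  \esum_(l in [set: S]) (tau n l * y l).
(** Expected sum of [y] over the states visited by the jump chain before its passage to [G], the
    initial state included. As [1 / qex l] is the mean holding time in [l], the choice
    [y l = f l / qex l] gives [E int_0^T f] when no absorbing state is reached. *)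
Definition pot (y : S -> \bar R) : \bar R := \esum_(n in [set: nat]) tsum n y.

Implicit Types x y z : S -> \bar R.
Local Notation ge0f x := (forall k, 0 <= x k).

Lemma step_in_ge0 x l : ge0f x -> 0 <= step_in x l.
Proof. by move=> x0; apply: esum_ge0 => k _; case: ifP => // _; exact: mule_ge0. Qed.

Lemma step_out_ge0 x l : ge0f x -> 0 <= step_out x l.
Proof. by move=> x0; apply: esum_ge0 => k _; case: ifP => // _; exact: mule_ge0. Qed.

Lemma tsum_ge0 n x : ge0f x -> 0 <= tsum n x.
Proof. by move=> x0; apply: esum_ge0 => k _; exact: mule_ge0. Qed.

Lemma pot_ge0 x : ge0f x -> 0 <= pot x.
Proof. by move=> x0; apply: esum_ge0 => n _; exact: tsum_ge0. Qed.

Lemma step_inD_out x l : ge0f x ->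
  step_in x l + step_out x l = \esum_(k in [set: S]) (p l k * x k).
Proof.
move=> x0; rewrite -esumD; last 2 first.
- by move=> k _; case: ifP => // _; exact: mule_ge0.
- by move=> k _; case: ifP => // _; exact: mule_ge0.
by apply: eq_esum => k _; case: ifP => _; rewrite ?adde0 ?add0e.
Qed.

Lemma sum_pjump l x : ge0f x ->
  \esum_(k in [set: S]) (p l k * x k) =
  (qex l)^-1%:E * \esum_(k in [set: S]) ((qo l k)%:E * x k).
Proof.
move=> x0; rewrite -esumZl.
- by apply: eq_esum => k _; rewrite /p pjumpE mulrC EFinM muleA.
- by rewrite lee_fin invr_ge0.
- by move=> k; apply: mule_ge0 => //; rewrite lee_fin.
Qed.

Lemma tsumD n x y : ge0f x -> ge0f y -> tsum n (fun l => x l + y l) = tsum n x + tsum n y.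
Proof.
move=> x0 y0; rewrite /tsum -esumD; try by move=> l _; exact: mule_ge0.
by apply: eq_esum => l _; rewrite ge0_muleDr.
Qed.

Lemma tsumZ n (a : \bar R) x : 0 <= a -> ge0f x -> tsum n (fun l => a * x l) = a * tsum n x.
Proof.
move=> a0 x0; rewrite /tsum -esumZl//; last by move=> l; exact: mule_ge0.
by apply: eq_esum => l _; rewrite muleCA.
Qed.

Lemma potD x y : ge0f x -> ge0f y -> pot (fun l => x l + y l) = pot x + pot y.
Proof.
move=> x0 y0; rewrite /pot -esumD; try by move=> l _; exact: tsum_ge0.
by apply: eq_esum => n _; exact: tsumD.
Qed.

Lemma potZ (a : \bar R) x : 0 <= a -> ge0f x -> pot (fun l => a * x l) = a * pot x.
Proof.
move=> a0 x0; rewrite /pot -esumZl//; last by move=> l; exact: tsum_ge0.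
by apply: eq_esum => n _; exact: tsumZ.
Qed.

(** Comparing only where the taboo probability is nonzero makes it possible later to divide by
    [qex l], by [taboo_nonabsorbing]. *)
Lemma le_tsum n x y : (forall l, tau n l != 0 -> x l <= y l) -> tsum n x <= tsum n y.
Proof.
move=> xy; apply: le_esum => l _; have [->|tN0] := eqVneq (tau n l) 0.
  by rewrite !mul0e.
by apply: lee_wpmul2l => //; exact: xy.
Qed.

Lemma le_pot x y : (forall n l, tau n l != 0 -> x l <= y l) -> pot x <= pot y.
Proof. by move=> xy; apply: le_esum => n _; apply: le_tsum => l; exact: xy. Qed.

Lemma tsum0 x : ge0f x -> tsum 0 x = x i.
Proof.
move=> x0; rewrite -[RHS](@esum_bump _ _ _ i)//; apply: eq_esum => l _ /=.
by rewrite /tau/=; case: eqVneq => [->|_]; rewrite ?mul1e ?mul0e.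
Qed.

Lemma tsum_step_out n x : ge0f x -> tsum n (step_out x) = tsum n.+1 x.
Proof.
move=> x0; transitivity (\esum_(l in [set: S]) \esum_(k in [set: S])
    (tau n l * (if k \in G then 0 else p l k * x k))).
  apply: eq_esum => l _; rewrite esumZl// => k; case: ifP => // _; exact: mule_ge0.
rewrite exchange_esumT; last first.
  by move=> l k; apply: mule_ge0 => //; case: ifP => // _; exact: mule_ge0.
apply: eq_esum => k _; rewrite /tau /=; case: ifP => _.
  by rewrite mul0e esum1// => l _; rewrite mule0.
rewrite -esumZr//; last by move=> l; exact: mule_ge0.
by apply: eq_esum => l _; rewrite muleA.
Qed.

Lemma fpdist_ge0 k : 0 <= fpdist q e i G k.
Proof.
rewrite /fpdist; case: ifP => // _; apply: esum_ge0 => n _; apply: esum_ge0 => l _.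
exact: mule_ge0.
Qed.

(** Decomposition by the number of jumps before the one that enters [G]: the left-hand side is the
    expectation of [x] at the passage time. *)
Lemma pot_step_in x : ge0f x ->
  pot (step_in x) = \esum_(k in [set: S]) (fpdist q e i G k * x k).
Proof.
move=> x0; transitivity (\esum_(n in [set: nat]) \esum_(k in [set: S]) \esum_(l in [set: S])
    (tau n l * (if k \in G then p l k * x k else 0))).
  apply: eq_esum => n _; rewrite -exchange_esumT.
    apply: eq_esum => l _; rewrite esumZl// => k; case: ifP => // _; exact: mule_ge0.
  by move=> l k; apply: mule_ge0 => //; case: ifP => // _; exact: mule_ge0.
rewrite exchange_esumT; last first.
  move=> n k; apply: esum_ge0 => l _; apply: mule_ge0 => //.
  by case: ifP => // _; exact: mule_ge0.
apply: eq_esum => k _; rewrite /fpdist; case: ifP => kG.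
  rewrite -esumZr//; last by move=> n; apply: esum_ge0 => l _; exact: mule_ge0.
  apply: eq_esum => n _; rewrite -esumZr//; last by move=> l; exact: mule_ge0.
  by apply: eq_esum => l _; rewrite muleA.
by rewrite mul0e esum1// => n _; rewrite esum1// => l _; rewrite mule0.
Qed.

(** A discrete Dynkin formula. All terms are nonnegative and kept on the side where they have a plus
    sign, so nothing infinite is ever subtracted; [tsum N x] is the remainder after [N] jumps. *)
Lemma pot_le_iter x y z N : ge0f x -> ge0f y -> ge0f z ->
  (forall n l, tau n l != 0 -> x l + y l <= z l + step_out x l) ->
  x i + \sum_(n < N) tsum n y <= \sum_(n < N) tsum n z + tsum N x.
Proof.
move=> x0 y0 z0 h; elim: N => [|N IH]; first by rewrite !big_ord0 adde0 add0e tsum0.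
rewrite !big_ord_recr/= addeA; apply: le_trans (leeD IH (lexx _)) _.
rewrite -!addeA leeD2l//; rewrite -tsumD// -tsum_step_out// -tsumD//; last first.
  by move=> l; exact: step_out_ge0.
by apply: le_tsum => l; exact: h.
Qed.

Lemma pot_ge_iter x y z N : ge0f x -> ge0f y -> ge0f z ->
  (forall n l, tau n l != 0 -> z l + step_out x l <= x l + y l) ->
  \sum_(n < N) tsum n z + tsum N x <= x i + \sum_(n < N) tsum n y.
Proof.
move=> x0 y0 z0 h; elim: N => [|N IH]; first by rewrite !big_ord0 adde0 add0e tsum0.
rewrite !big_ord_recr/= addeA; apply: le_trans (leeD IH (lexx _)).
rewrite -!addeA leeD2l//; rewrite -tsumD// -tsum_step_out// -tsumD//; last first.
  by move=> l; exact: step_out_ge0.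
by apply: le_tsum => l; exact: h.
Qed.

Lemma pot_le x y z : ge0f x -> ge0f y -> ge0f z ->
  (forall n l, tau n l != 0 -> x l + y l <= z l + step_out x l) ->
  tsum n x @[n --> \oo] --> 0 ->
  x i + pot y <= pot z.
Proof.
move=> x0 y0 z0 h cvx.
have tz0 n := tsum_ge0 n z0.
have ty0 n := tsum_ge0 n y0.
have cv : pot z + tsum n x @[n --> \oo] --> pot z.
  rewrite -[X in _ --> X]adde0; apply: cvgeD => //; last exact: cvg_cst.
  by rewrite fin_num_adde_defl.
suff h' : forall M, x i + \sum_(n < M) tsum n y <= pot z.
  (* Moving [x i] to the other side requires it to be finite; if it is infinite, [h'] with [M = 0]
     already gives [pot z = +oo]. *)
  case xi : (x i) (x0 i) => [r| |]// _; last first.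
    by have := h' 0%N; rewrite big_ord0 adde0 xi leye_eq => /eqP ->; rewrite leey.
  rewrite -leeBrDl//; apply: esum_nat_le => // M; rewrite leeBrDl//.
  by rewrite -xi; exact: h'.
move=> M; apply: (@cvge_to_ge _ _ _ _ _ _ _ cv).
near=> N.
apply: le_trans (le_trans (pot_le_iter N x0 y0 z0 h) _).
  rewrite leeD2l// -!(big_mkord xpredT (fun n => tsum n y)) lee_sum_nneg_natr//.
  by near: N; exists M.
by rewrite leeD2r//; exact: esum_nat_ge.
Unshelve. all: by end_near. Qed.

(** In this direction the remainder is dropped by its sign, so no convergence is required. *)
Lemma pot_ge x y z : ge0f x -> ge0f y -> ge0f z ->
  (forall n l, tau n l != 0 -> z l + step_out x l <= x l + y l) ->
  pot z <= x i + pot y.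
Proof.
move=> x0 y0 z0 h; apply: esum_nat_le => [n|N]; first exact: tsum_ge0.
apply: (@le_trans _ _ (x i + \sum_(n < N) tsum n y)); last first.
  by rewrite leeD2l//; apply: esum_nat_ge => n; exact: tsum_ge0.
apply: le_trans (pot_ge_iter N x0 y0 z0 h).
by rewrite leeDl// tsum_ge0.
Qed.

Lemma step_out_esum (x : nat -> S -> \bar R) l : (forall n k, 0 <= x n k) ->
  step_out (fun k => \esum_(n in [set: nat]) x n k) l =
  \esum_(n in [set: nat]) step_out (x n) l.
Proof.
move=> x0; rewrite [RHS]exchange_esumT; last first.
  by move=> n k; case: ifP => // _; exact: mule_ge0.
apply: eq_esum => k _; case: ifP => _; first by rewrite esum1.
by rewrite esumZl.
Qed.

(* Expected total of [d] over the jumps before the first passage to [G]. *)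
Definition passage_sum (d : S -> \bar R) l : \bar R :=
  \esum_(n in [set: nat]) iter n step_out d l.

Let iter0 d n l : ge0f d -> 0 <= iter n step_out d l.
Proof. by move=> d0; elim: n l => [|n IH] l //=; exact: step_out_ge0. Qed.

Lemma passage_sum_ge0 d l : ge0f d -> 0 <= passage_sum d l.
Proof. by move=> d0; apply: esum_ge0 => n _; exact: iter0. Qed.

Lemma passage_sumE d l : ge0f d ->
  passage_sum d l = d l + step_out (passage_sum d) l.
Proof.
move=> d0; rewrite /passage_sum step_out_esum; last by move=> n k; exact: iter0.
by rewrite esum_nat_recl// => n; exact: iter0.
Qed.

(** Advancing [N] jumps under the taboo and then summing [d] up to passage gives the tail from [N]
    of the convergent series [pot d]. *)
Lemma tsum_passage_cvg0 d : ge0f d -> pot d < +oo ->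
  tsum n (passage_sum d) @[n --> \oo] --> 0.
Proof.
move=> d0 dfin.
have tit n N : tsum N (iter n step_out d) = tsum (N + n) d.
  elim: n N => [|n IH] N; first by rewrite addn0.
  rewrite iterS tsum_step_out; last by move=> k; exact: iter0.
  by rewrite IH addSnnS.
have E N : tsum N (passage_sum d) = \sum_(N <= n <oo) tsum n d.
  transitivity (\esum_(n in [set: nat]) tsum N (iter n step_out d)).
    rewrite [RHS]exchange_esumT; last by move=> n k; apply: mule_ge0 => //; exact: iter0.
    by apply: eq_esum => l _; rewrite esumZl// => n; exact: iter0.
  rewrite -(@nneseries_addn _ (fun n => tsum n d) N (fun n => tsum_ge0 n d0)).
  rewrite nneseries_esumT; last by move=> n; exact: tsum_ge0.
  by apply: eq_esum => n _; rewrite tit addnC.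
under eq_fun do rewrite E.
apply: nneseries_tail_cvg; last by move=> n _; exact: tsum_ge0.
by rewrite nneseries_esumT// => n; exact: tsum_ge0.
Qed.

Hypothesis hit1 : hitprob q e i G = 1.

Let one0 (k : S) : 0 <= (fun=> 1 : \bar R) k. Proof. by []. Qed.

Lemma sum_fpdist : \esum_(k in [set: S]) fpdist q e i G k = 1.
Proof.
rewrite -hit1 /hitprob [RHS]esum_mkcond; apply: eq_esum => k _.
by case: ifP => // kG; rewrite /fpdist kG.
Qed.

Lemma pot_step_in1 : pot (step_in (fun=> 1)) = 1.
Proof.
rewrite pot_step_in// -[RHS]sum_fpdist.
by apply: eq_esum => k _; rewrite mule1.
Qed.

(** The row of [pjump] at an absorbing state is zero; [absorb] supplies the missing mass, so that
    the total in [mass] is [1] at every state. *)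
Let absorb l : \bar R := if qex l == 0%R then 1 else 0.

Let absorb0 l : 0 <= absorb l. Proof. by rewrite /absorb; case: ifP. Qed.

Let mass l : step_in (fun=> 1) l + absorb l + step_out (fun=> 1) l = 1.
Proof.
rewrite addeAC step_inD_out// sum_pjump//.
under eq_esum do rewrite mule1.
rewrite sum_qo -EFinM /absorb; case: eqVneq => [->|qN0].
  by rewrite mulr0 add0e.
by rewrite mulVf// adde0.
Qed.

Let z0 l : 0 <= step_in (fun=> 1) l + absorb l.
Proof. by rewrite adde_ge0// step_in_ge0. Qed.


Let zero0 (k : S) : 0 <= (fun=> 0 : \bar R) k. Proof. by []. Qed.

(** The probabilities of entering [G] and of being absorbed before that add up to at most [1], and
    the former is already [1]. This protects against the convention [0^-1 = 0] in mean holding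
    times. *)
Lemma taboo_nonabsorbing n l : taboo q e i G n l != 0 -> qex l != 0%R.
Proof.
move=> tN0; apply/negP => /eqP q0.
have := pot_ge one0 zero0 z0.
rewrite potD//; last by move=> k; exact: step_in_ge0.
rewrite pot_step_in1 [X in _ -> _ <= _ + X]/pot esum1; last first.
  by move=> m _; apply: esum1 => k _; rewrite mule0.
rewrite leeD2lE// => h.
have /esum_eq0 pot0 : pot absorb = 0.
  by apply/eqP; rewrite eq_le pot_ge0// h// => m k _; rewrite mass adde0.
have /(_ l) := esum_eq0 (fun k => mule_ge0 (tau0 n k) (absorb0 k))
  (pot0 (fun m => tsum_ge0 m absorb0) n).
by rewrite /absorb q0 eqxx mule1 => /eqP; rewrite (negPf tN0).
Qed.

(** The probability of avoiding [G] for [N] jumps is at most [1] minus that of a passage within [N]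
    jumps, which tends to [1]. *)
Lemma tsum1_cvg0 : tsum n (fun=> 1) @[n --> \oo] --> 0.
Proof.
pose F N := \sum_(n < N) tsum n (step_in (fun=> 1)).
have tin n : 0 <= tsum n (step_in (fun=> 1)).
  by apply: tsum_ge0 => l; exact: step_in_ge0.
have cvF : F N @[N --> \oo] --> 1.
  rewrite -pot_step_in1 /pot -nneseries_esumT// /F.
  under eq_fun do rewrite -(big_mkord xpredT (fun n => tsum n (step_in (fun=> 1)))).
  exact: is_cvg_nneseries.
have cv : 1 - F N @[N --> \oo] --> 0.
  rewrite -[X in _ --> X](@subee _ 1)//; apply: cvgeB => //; exact: cvg_cst.
apply: (squeeze_cvge _ (cvg_cst 0) cv); near=> N.
rewrite tsum_ge0//= leeBrDr.
  rewrite addeC; apply: le_trans (pot_ge_iter N one0 zero0 _ _) _.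
  - by move=> l; exact: step_in_ge0.
  - move=> n l tN0; rewrite adde0 -[leRHS](mass l) leeD2r//.
    by rewrite leeDl.
  - by rewrite big1 ?adde0// => n _; apply: esum1 => l _; rewrite mule0.
rewrite ge0_fin_numE; last exact: sume_ge0.
apply: (@le_lt_trans _ _ 1); last exact: ltry.
by rewrite -[leRHS]pot_step_in1; exact: esum_nat_ge.
Unshelve. all: by end_near. Qed.

End TabooPotential.

(** * Relative values and the vanishing discount limit *)

Lemma cvg_weighted_sum {R : realType} (T : choiceType) (s : seq T) (w : T -> R)
    (x : nat -> T -> R) (xl : T -> R) :
  (forall j, x n j @[n --> \oo] --> xl j) ->
  (\sum_(j <- s) w j * x n j)%R @[n --> \oo] --> (\sum_(j <- s) w j * xl j)%R.
Proof.
move=> cvx; elim: s => [|j s IH].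
  by under eq_fun do rewrite big_nil; rewrite big_nil; exact: cvg_cst.
under eq_fun do rewrite big_cons; rewrite big_cons.
by apply: cvgD => //; apply: cvgMl_tmp; exact: cvx.
Qed.

(** Dominated convergence in the form of an inequality: a finite set [X] carries all but [eps] of
    the dominating sum, and on [X] the limit is taken termwise. *)
Lemma esum_dominated_limit {R : realType} (T : choiceType) (w : T -> R)
    (x : nat -> T -> R) (xl B : T -> R) (y K : nat -> R) (yl Kl : R) :
  (forall j, 0 <= w j)%R -> (forall n j, 0 <= x n j /\ x n j <= B j)%R ->
  (forall j, x n j @[n --> \oo] --> xl j) ->
  \esum_(j in [set: T]) (w j * B j)%:E < +oo ->
  y @ \oo --> yl -> K @ \oo --> Kl ->
  (forall n, (y n)%:E <= (K n)%:E + \esum_(j in [set: T]) (w j * x n j)%:E) ->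
  yl%:E <= Kl%:E + \esum_(j in [set: T]) (w j * xl j)%:E.
Proof.
move=> w0 xB cvx finB cvy cvK hy.
have B0 j : (0 <= B j)%R by have [h1 h2] := xB 0%N j; exact: le_trans h2.
have wB0 j : 0 <= (w j * B j)%:E by rewrite lee_fin mulr_ge0.
apply/lee_addgt0Pr => eps eps0.
have finB' : \esum_(j in [set: T]) (w j * B j)%:E \is a fin_num.
  by rewrite ge0_fin_numE//; exact: esum_ge0.
have [_ [X [finX _] <-] hX] := ub_ereal_sup_adherent eps0 finB'.
have tail : \esum_(j in ~` X) (w j * B j)%:E <= eps%:E.
  have := esumID X setT (fun j => (w j * B j)%:E) (fun j _ => wB0 j).
  rewrite !setTI (esum_fset finX)// => E.
  have finXs : \sum_(j \in X) (w j * B j)%:E \is a fin_num.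
    by rewrite fsbig_finite//= sumEFin.
  by move: hX; rewrite -/(esum _ _) E lteBlDr// lteD2lE//; exact: ltW.
pose s : seq T := fset_set X.
have xl0 j : (0 <= xl j)%R.
  by apply: (ler_cvg_to (cvg_cst 0%R) (cvx j)); near=> n; have [] := xB n j.
have sX (u : T -> R) : (forall j, 0 <= u j)%R ->
    \esum_(j in X) (w j * u j)%:E = (\sum_(j <- s) w j * u j)%:E.
  move=> u0; rewrite esum_fset//; last by move=> j _; rewrite lee_fin mulr_ge0.
  by rewrite fsbig_finite//= sumEFin.
have hfin n : (y n <= K n + \sum_(j <- s) w j * x n j + eps)%R.
  have x0 j : (0 <= x n j)%R by have [] := xB n j.
  rewrite -lee_fin !EFinD; apply: le_trans (hy n) _.
  rewrite -addeA leeD2l// (esumID X); last by move=> j _; rewrite lee_fin mulr_ge0.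
  rewrite !setTI sX// leeD2l//; apply: le_trans tail.
  by apply: le_esum => j _; rewrite lee_fin ler_wpM2l//; have [] := xB n j.
have lim : (yl <= Kl + \sum_(j <- s) w j * xl j + eps)%R.
  apply: (ler_cvg_to cvy (g := fun n => K n + \sum_(j <- s) w j * x n j + eps)%R).
    apply: cvgD; last exact: cvg_cst.
    by apply: cvgD => //; exact: cvg_weighted_sum.
  by near=> n; exact: hfin.
rewrite -lee_fin !EFinD in lim; apply: le_trans lim _.
rewrite leeD2r// leeD2l// -sX//; apply: esum_ge; exists X; first by split.
by rewrite esum_fset// => j _; rewrite lee_fin mulr_ge0.
Unshelve. all: by end_near. Qed.

Section RelativeValue.
Context {R : realType} {S : countType} {Act : choiceType}.
Variables (A : S -> {fset Act}) (q : S -> Act -> S -> R) (c : S -> Act -> R).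
Hypothesis hA : forall i, A i != fset0.
Hypothesis hq_nonneg : forall i a j, a \in A i -> j != i -> (0 <= q i a j)%R.
Hypothesis hq_cons : forall i a, a \in A i -> sumS (fun j => q i a j) = 0.
Hypothesis hc : forall i a, a \in A i -> (0 <= c i a)%R.
Variable e : S -> Act.
Hypothesis eA : forall l, e l \in A l.
Local Notation qo l k := (qoff q l (e l) k).
Local Notation qex l := (qe q e l).
Local Notation ce l := (c l (e l)).

Lemma stat_off_ge0 l k : (0 <= qo l k)%R.
Proof. exact: (qoff_ge0 hq_nonneg). Qed.
Let qo0 := stat_off_ge0.

Lemma stat_off_sum l : \esum_(k in [set: S]) (qo l k)%:E = (qex l)%:E.
Proof. by have [] := conservative hq_nonneg hq_cons (eA l). Qed.
Let sum_qo := stat_off_sum.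

Lemma stat_exit_ge0 l : (0 <= qex l)%R.
Proof. by rewrite oppr_ge0; have [] := conservative hq_nonneg hq_cons (eA l). Qed.

Let ce0 l : (0 <= ce l)%R. Proof. exact: hc. Qed.

(** Conservativity allows adding the constant [L] to [h], which makes every off-diagonal term
    nonnegative. The identity [E] keeps positive and negative parts on opposite sides; finiteness of
    [g] then excludes infinite values. *)
Lemma poisson_shift (h : S -> R) (L g Phi : R) l : (0 <= L)%R ->
  (forall k, 0 <= h k + L)%R ->
  g%:E = (ce l + Phi)%:E + sumS (fun k => h k * q l (e l) k)%R ->
  (qex l * (h l + L) + g)%:E =
  (ce l + Phi)%:E + \esum_(k in [set: S]) (qo l k * (h k + L))%:E.
Proof.
move=> L0 hL; rewrite /sumS.
set P := \esum_(k in [set: S]) (Num.max (h k * _) 0)%:E.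
set N := \esum_(k in [set: S]) (Num.max (- (h k * _)) 0)%:E.
set X := \esum_(k in [set: S]) _.
have mx0 (u : R) : 0 <= (Num.max u 0)%:E by rewrite lee_fin le_max lexx orbT.
have X0 : 0 <= X by apply: esum_ge0 => k _; rewrite lee_fin mulr_ge0.
have P0 : 0 <= P by apply: esum_ge0.
have N0 : 0 <= N by apply: esum_ge0.
have qL0 : 0 <= (qex l * L)%:E by rewrite lee_fin mulr_ge0// stat_exit_ge0.
have qh0 : 0 <= (qex l * (h l + L))%:E by rewrite lee_fin mulr_ge0// stat_exit_ge0.
have E : X + N + (qex l * L)%:E = P + (qex l * L)%:E + (qex l * (h l + L))%:E.
  have eS : \esum_(k in [set: S]) (qo l k * L)%:E = (qex l * L)%:E.
    under eq_esum do rewrite EFinM.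
    by rewrite esumZr ?lee_fin// ?sum_qo ?EFinM// => k; rewrite lee_fin.
  rewrite -[in RHS]eS -(@esum_bump _ _ (qex l * L)%:E l)//.
  rewrite -(@esum_bump _ _ (qex l * (h l + L))%:E l)//.
  have b0 (u : \bar R) k : 0 <= u -> 0 <= (if k == l then u else 0) by case: ifP.
  have t0 k : 0 <= (qo l k * (h k + L))%:E by rewrite lee_fin mulr_ge0.
  have s0 k : 0 <= (qo l k * L)%:E by rewrite lee_fin mulr_ge0.
  rewrite -!esumD; try by move=> k _; rewrite ?adde_ge0 ?b0.
  apply: eq_esum => k _; rewrite /qoff; case: eqVneq => [->|kl].
    rewrite -!EFinD /qe; congr EFin; case: (lerP (h l * q l (e l) l)%R 0) => hq.
      by rewrite max_l ?oppr_ge0//; ring.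
    by rewrite max_r ?oppr_le0 ?(ltW hq)//; ring.
  rewrite !adde0 -!EFinD; congr EFin; case: (lerP (h k * q l (e l) k)%R 0) => hq.
    by rewrite max_l ?oppr_ge0//; ring.
  by rewrite max_r ?oppr_le0 ?(ltW hq)//; ring.
case: P P0 E => [u| |]// _; case: N N0 => [t| |]// _; case: X X0 => [x| |]// _.
rewrite -!EFinD => -[E1] [->]; congr EFin.
by move: E1; lra.
Qed.

Section OneDiscount.
Variables (alpha : R) (i0 : S) (L : R) (J : S -> R).
Hypothesis alpha0 : (0 < alpha)%R.
Hypothesis L0 : (0 <= L)%R.
Hypothesis JE : forall l, Jstar A q c alpha l = (J l)%:E.
Hypothesis JL : forall l, (0 <= J l - J i0 + L)%R.

Definition relval l : R := (J l - J i0 + L)%R.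

Let J0 l : (0 <= J l)%R.
Proof. by rewrite -lee_fin -JE; exact: Jstar_ge0. Qed.

(** Substituting [J = relval + J i0 - L] in the Bellman inequality, the constants cancel in the rate
    terms by conservativity, and [alpha relval l >= 0] is dropped from the left. *)
Lemma relval_bellman l :
  (qex l * relval l + alpha * J i0)%:E <=
  (ce l + alpha * L)%:E + \esum_(k in [set: S]) (qo l k * relval k)%:E.
Proof.
have := Jstar_bellman_le hA hq_nonneg hq_cons hc alpha0 (eA l).
rewrite JE /jump_sum.
have -> : \esum_(k in [set: S]) ((qo l k)%:E * Jstar A q c alpha k) =
    \esum_(k in [set: S]) (qo l k * J k)%:E.
  by apply: eq_esum => k _; rewrite JE EFinM.
have : \esum_(k in [set: S]) (qo l k * relval k)%:E + (qex l * J i0)%:E =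
    \esum_(k in [set: S]) (qo l k * J k)%:E + (qex l * L)%:E.
  rewrite !EFinM -sum_qo -!esumZr ?lee_fin//; try by move=> k; rewrite lee_fin.
  rewrite -!esumD; try by move=> k _; rewrite -?EFinM lee_fin ?mulr_ge0// JL.
  by apply: eq_esum => k _; rewrite -!EFinM -!EFinD /relval; congr EFin; ring.
have : 0 <= \esum_(k in [set: S]) (qo l k * relval k)%:E.
  by apply: esum_ge0 => k _; rewrite lee_fin mulr_ge0// JL.
have : 0 <= \esum_(k in [set: S]) (qo l k * J k)%:E.
  by apply: esum_ge0 => k _; rewrite lee_fin mulr_ge0.
case: (\esum_(k in _) (qo l k * relval k)%:E) => [x| |]//; last first.
  by move=> *; rewrite addey// leey.
case: (\esum_(k in _) _) => [y| |]// _ _; rewrite -!EFinD => -[xy].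
rewrite -EFinM !lee_fin -/(qex l) => h.
have : (0 <= alpha * (J l - J i0 + L))%R by rewrite mulr_ge0 ?JL// ltW.
by move: h xy; rewrite /relval; move: (qex l) => z; lra.
Qed.

Section Passage.
Variables (i : S) (G : set S).
Hypothesis hit1 : hitprob q e i G = 1.
Let rc l : \bar R := ((qex l)^-1 * ce l)%:E.
Let r l : \bar R := ((qex l)^-1)%:E.
Hypothesis rc_fin : pot q e i G rc < +oo.
Hypothesis fpJ_fin : \esum_(k in [set: S]) (fpdist q e i G k * (J k)%:E) < +oo.

Let r0 l : 0 <= r l. Proof. by rewrite lee_fin invr_ge0 stat_exit_ge0. Qed.
Let rc0 l : 0 <= rc l.
Proof. by rewrite lee_fin mulr_ge0// invr_ge0 stat_exit_ge0. Qed.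

Let JEE l : 0 <= (J l)%:E. Proof. by rewrite lee_fin. Qed.

(** Expected cost during one holding time plus the payment [J] if the next jump enters [G]. At
    absorbing states the value [+oo] replaces the [0] that [(qex l)^-1] would produce, which would
    be no upper bound. *)
Let d l : \bar R :=
  if qex l == 0%R then +oo else rc l + step_in q e G (fun k => (J k)%:E) l.

Let d0 l : 0 <= d l.
Proof. by rewrite /d; case: ifP => // _; rewrite adde_ge0// (step_in_ge0 qo0 sum_qo). Qed.

(** Outside [G] the minimum of [J] and the passage cost [w] is taken, and [J] is kept on [G]. This
    is a supersolution: where [J] is the smaller its own witness works, elsewhere [e] does, by the
    first-step equation of [w], as discounting only enlarges the right-hand side. *)
Lemma Jstar_le_passage l : l \notin G -> (J l)%:E <= passage_sum q e G d l.
Proof.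
move=> lG; set w := passage_sum q e G d.
have w0 k : 0 <= w k by exact: (passage_sum_ge0 qo0 sum_qo).
pose v k := if k \in G then (J k)%:E else mine (J k)%:E (w k).
have v0 k : 0 <= v k by rewrite /v; case: ifP => // _; rewrite le_min JEE w0.
have vJ k : v k <= (J k)%:E by rewrite /v; case: ifP => // _; rewrite ge_min lexx.
suff supv : supersolution A q c alpha v.
  have := Jstar_le hq_nonneg hq_cons hc alpha0 l v0 supv.
  by rewrite JE /v (negPf lG) => /le_trans; apply; rewrite ge_min lexx orbT.
move=> k; have [b bk hb] := Jstar_supersolution hA hq_nonneg hq_cons hc alpha0 k.
have hbv : (c k b)%:E + jump_sum q k b v <= (alpha - q k b k)%:E * (J k)%:E.
  rewrite -JE; apply: le_trans hb; rewrite leeD2l//.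
  by apply: (le_jump_sum hq_nonneg) => // k'; rewrite JE.
rewrite {2}/v; case: ifPn => kG; first by exists b.
have [_|wJ] := leP (J k)%:E (w k); first by exists b.
have wfin : w k \is a fin_num by rewrite ge0_fin_numE// (lt_le_trans wJ)// leey.
exists (e k) => //.
(* [w k] lies below the finite [J k], whereas [d] is infinite at absorbing states. *)
have qN0 : qex k != 0%R.
  apply/eqP => qk0; move: wJ; rewrite /w (passage_sumE qo0 sum_qo)// /d qk0 eqxx.
  rewrite addye// -ltNye; apply: lt_le_trans (step_out_ge0 qo0 sum_qo _ _ _); first exact: ltNy0.
  exact: w0.
have qpos : (0 < qex k)%R by rewrite lt_neqAle eq_sym qN0 stat_exit_ge0.
have wE : (qex k)%:E * w k = (ce k)%:E + \esum_(k' in [set: S])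
    ((qo k k')%:E * (if k' \in G then (J k')%:E else w k')).
  rewrite /w (passage_sumE qo0 sum_qo)// -/w /d (negPf qN0) -addeA.
  have -> : step_in q e G (fun k => (J k)%:E) k + step_out q e G w k =
      r k * \esum_(k' in [set: S]) ((qo k k')%:E * (if k' \in G then (J k')%:E else w k')).
    rewrite -(sum_pjump qo0 sum_qo); last by move=> k'; case: ifP.
    rewrite -(step_inD_out qo0 sum_qo G); last by move=> k'; case: ifP.
    by congr (_ + _); apply: eq_esum => k' _; case: ifP.
  have X0 : 0 <= \esum_(k' in [set: S]) ((qo k k')%:E * (if k' \in G then (J k')%:E else w k')).
    by apply: esum_ge0 => k' _; apply: mule_ge0; [rewrite lee_fin|case: ifP].
  rewrite ge0_muleDr//; last exact: mule_ge0.
  by rewrite muleA -!EFinM mulrA mulfV// !mul1r mul1e.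
apply: (@le_trans _ _ ((qex k)%:E * w k)); last first.
  apply: lee_wpmul2r => //; rewrite lee_fin.
  by rewrite [leRHS](_ : _ = alpha + qex k)%R// lerDr ltW.
rewrite wE leeD2l//; apply: le_esum => k' _; apply: lee_wpmul2l; first by rewrite lee_fin.
by rewrite /v; case: ifP => // _; rewrite ge_min lexx orbT.
Qed.

Let hp l : \bar R := (relval l)%:E.
Let hp0 l : 0 <= hp l. Proof. by rewrite lee_fin JL. Qed.

(** [pot d] is finite because absorbing states carry no taboo mass. The passage bound applies from
    [n = 1] on, since only the initial state may lie in [G]. *)
Lemma tsum_Jstar_cvg0 : tsum q e i G n (fun l => (J l)%:E) @[n --> \oo] --> 0.
Proof.
have dfin : pot q e i G d < +oo.
  apply: (@le_lt_trans _ _ (pot q e i G (fun l => rc l + step_in q e G (fun k => (J k)%:E) l))).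
    apply: (le_pot qo0 sum_qo) => n l tN0; rewrite /d.
    by rewrite (negPf (taboo_nonabsorbing qo0 sum_qo hit1 tN0)).
  rewrite (potD qo0 sum_qo)//; last by move=> l; exact: (step_in_ge0 qo0 sum_qo).
  by rewrite (pot_step_in qo0 sum_qo)// lte_add_pinfty.
have tG m k : (0 < m)%N -> taboo q e i G m k != 0 -> k \notin G.
  by case: m => //= m _; case: ifP => //; rewrite eqxx.
have cvd := tsum_passage_cvg0 qo0 sum_qo d0 dfin.
apply: (squeeze_cvge _ (cvg_cst 0) cvd).
near=> n; rewrite (tsum_ge0 qo0 sum_qo)//=; apply: (le_tsum qo0 sum_qo) => l tN0.
apply: Jstar_le_passage; apply: tG tN0.
by near: n; exists 1%N.
Unshelve. all: by end_near. Qed.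

Lemma tsum_relval_cvg0 : tsum q e i G n hp @[n --> \oo] --> 0.
Proof.
have LE0 : 0 <= L%:E by rewrite lee_fin.
have cv : tsum q e i G n (fun l => (J l)%:E) + L%:E * tsum q e i G n (fun=> 1)
    @[n --> \oo] --> 0.
  rewrite -[X in _ --> X]adde0; apply: cvgeD => //; first exact: tsum_Jstar_cvg0.
  by rewrite -(mule0 L%:E); apply: cvgeZl => //; exact: (tsum1_cvg0 qo0 sum_qo hit1).
apply: (squeeze_cvge _ (cvg_cst 0) cv); near=> n.
rewrite (tsum_ge0 qo0 sum_qo)//= -(tsumZ qo0 sum_qo)// -(tsumD qo0 sum_qo)//; last first.
  by move=> l; rewrite mule1.
apply: (le_tsum qo0 sum_qo) => l _; rewrite mule1 -EFinD lee_fin /relval.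
by rewrite lerD2r gerBl.
Unshelve. all: by end_near. Qed.

(** [relval_bellman] divided by [qex l] is the one-jump inequality of [pot_le], and
    [tsum_relval_cvg0] disposes of the remainder. *)
Lemma relval_passage :
  hp i + (alpha * J i0)%:E * pot q e i G r <=
  pot q e i G rc + (alpha * L)%:E * pot q e i G r +
  \esum_(k in [set: S]) (fpdist q e i G k * hp k).
Proof.
have aJ0 : 0 <= (alpha * J i0)%:E by rewrite lee_fin mulr_ge0// ltW.
have aL0 : 0 <= (alpha * L)%:E by rewrite lee_fin mulr_ge0// ltW.
have aLr0 l : 0 <= (alpha * L)%:E * r l by exact: mule_ge0.
have in0 l : 0 <= step_in q e G hp l by exact: (step_in_ge0 qo0 sum_qo).
have rcr0 l : 0 <= rc l + (alpha * L)%:E * r l by exact: adde_ge0.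
rewrite -!(potZ qo0 sum_qo)// -(potD qo0 sum_qo)// -(pot_step_in qo0 sum_qo)//.
rewrite -(potD qo0 sum_qo)//; apply: (pot_le qo0 sum_qo) => //.
- by move=> l; exact: mule_ge0.
- by move=> l; exact: adde_ge0.
- move=> n l tN0; have qN0 := taboo_nonabsorbing qo0 sum_qo hit1 tN0.
  rewrite -[leRHS]addeA (step_inD_out qo0 sum_qo)// (sum_pjump qo0 sum_qo)//.
  have X0 : 0 <= \esum_(k in [set: S]) ((qo l k)%:E * hp k).
    by apply: esum_ge0 => k _; rewrite mule_ge0// lee_fin.
  have := relval_bellman l.
  under eq_esum do rewrite EFinM.
  move=> /(lee_wpmul2l (r0 l)); rewrite [leRHS]ge0_muleDr//; last first.
    by rewrite lee_fin addr_ge0// mulr_ge0// ltW.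
  rewrite (_ : r l * (qex l * relval l + alpha * J i0)%:E = hp l + (alpha * J i0)%:E * r l).
    rewrite (_ : r l * (ce l + alpha * L)%:E = rc l + (alpha * L)%:E * r l)//.
    by rewrite -!EFinM -EFinD; congr EFin; ring.
  by rewrite -!EFinM -EFinD; congr EFin; field.
- exact: tsum_relval_cvg0.
Qed.

End Passage.
End OneDiscount.
End RelativeValue.

(** * Passage to the limit along the discount rates *)

Section VanishingDiscount.
Context {R : realType} {S : countType} {Act : choiceType}.
Variables (A : S -> {fset Act}) (q : S -> Act -> S -> R) (c : S -> Act -> R).
Hypothesis hA : forall i, A i != fset0.
Hypothesis hq_nonneg : forall i a j, a \in A i -> j != i -> (0 <= q i a j)%R.
Hypothesis hq_cons : forall i a, a \in A i -> sumS (fun j => q i a j) = 0.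
Hypothesis hc : forall i a, a \in A i -> (0 <= c i a)%R.
Variables (alpha : nat -> R) (i0 : S) (H : S -> R) (L : R).
Hypothesis alpha_gt0 : forall n, (0 < alpha n)%R.
Hypothesis alpha_cvg0 : alpha @ \oo --> 0%R.
Variable J : nat -> S -> R.
Hypothesis JE : forall n l, Jstar A q c (alpha n) l = (J n l)%:E.
Hypothesis hH : forall i, (0 <= H i)%R.
Hypothesis hrelH : forall i n, hrel A q c (alpha n) i0 i <= (H i)%:E.
Hypothesis hL : (0 <= L)%R.
Hypothesis hrelL : forall i n, (- L)%:E <= hrel A q c (alpha n) i0 i.
Variables (g : R) (h : S -> R).
Hypothesis hg : (fun n => (alpha n)%:E * Jstar A q c (alpha n) i0) @ \oo --> g%:E.
Hypothesis hh : forall j, (fun n => hrel A q c (alpha n) i0 j) @ \oo --> (h j)%:E.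
Variable e : S -> Act.
Hypothesis eA : forall l, e l \in A l.
Variable Phi : S -> R.
Hypothesis Phi0 : forall i, (0 <= Phi i)%R.
Hypothesis hPhi : forall i, g%:E =
  (c i (e i) + Phi i)%:E + sumS (fun j => (h j * q i (e i) j)%R).
Local Notation qo l k := (qoff q l (e l) k).
Local Notation qex l := (qe q e l).
Local Notation ce l := (c l (e l)).

Let qo0 := stat_off_ge0 hq_nonneg eA.
Let sum_qo := stat_off_sum hq_nonneg hq_cons eA.
Let qex0 := stat_exit_ge0 hq_nonneg hq_cons eA.
Let ce0 l : (0 <= ce l)%R. Proof. exact: hc. Qed.

Let J0 n l : (0 <= J n l)%R. Proof. by rewrite -lee_fin -JE; exact: Jstar_ge0. Qed.

Let hrelE n l : hrel A q c (alpha n) i0 l = (J n l - J n i0)%:E.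
Proof. by rewrite /hrel !JE EFinB. Qed.

Let JL n l : (0 <= J n l - J n i0 + L)%R.
Proof. by rewrite -lerBlDr sub0r -lee_fin -hrelE. Qed.

Let hp n l : R := relval i0 L (J n) l.

Let hpB n l : (0 <= hp n l /\ hp n l <= H l + L)%R.
Proof.
split; first exact: JL.
by have := hrelH l n; rewrite hrelE lee_fin /hp /relval lerD2r.
Qed.

Let hp_cvg l : hp n l @[n --> \oo] --> (h l + L)%R.
Proof.
apply: cvgD; last exact: cvg_cst.
rewrite (_ : (fun n => _) = fine \o (fun n => hrel A q c (alpha n) i0 l)).
  by apply: fine_cvg; exact: hh.
by apply/funext => n /=; rewrite hrelE.
Qed.

Let theta_cvg : (alpha n * J n i0)%R @[n --> \oo] --> g.
Proof.
rewrite (_ : (fun n => _) = fine \o (fun n => (alpha n)%:E * Jstar A q c (alpha n) i0)).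
  by apply: fine_cvg; exact: hg.
by apply/funext => n /=; rewrite JE.
Qed.

Let g0 : (0 <= g)%R.
Proof.
apply: (ler_cvg_to (cvg_cst 0%R) theta_cvg); near=> n.
by rewrite mulr_ge0// ltW.
Unshelve. all: by end_near. Qed.

Let hs0 l : (0 <= h l + L)%R.
Proof.
apply: (ler_cvg_to (cvg_cst 0%R) (@hp_cvg l)); near=> n.
exact: JL.
Unshelve. all: by end_near. Qed.

Let poisson l : (qex l * (h l + L) + g)%:E =
  (ce l + Phi l)%:E + \esum_(k in [set: S]) (qo l k * (h k + L))%:E.
Proof. exact: (poisson_shift hq_nonneg hq_cons eA hL hs0 (hPhi l)). Qed.

(** The limit of [relval_bellman] at [i], taken under the bound [H + L], is the Poisson equation
    with [Phi i] removed and [<=] in place of equality; hence [Phi i <= 0]. *)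
Lemma gap0_one_step i :
  \esum_(k in [set: S]) (qo i k * H k)%:E < +oo -> Phi i = 0%R.
Proof.
move=> finH.
have finHL : \esum_(k in [set: S]) (qo i k * (H k + L))%:E < +oo.
  under eq_esum do rewrite mulrDr EFinD.
  rewrite esumD; try by move=> k _; rewrite lee_fin mulr_ge0.
  rewrite lte_add_pinfty//; under eq_esum do rewrite EFinM.
  rewrite esumZr ?lee_fin//; last by move=> k; rewrite lee_fin.
  by rewrite sum_qo -EFinM ltry.
have cvL : (qex i * hp n i + alpha n * J n i0)%R @[n --> \oo] -->
    (qex i * (h i + L) + g)%R.
  by apply: cvgD => //; apply: cvgMl_tmp; exact: hp_cvg.
have cvK : (ce i + alpha n * L)%R @[n --> \oo] --> (ce i + 0 * L)%R.
  by apply: cvgD; [exact: cvg_cst|apply: cvgMr_tmp].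
have := esum_dominated_limit (qo0 i) hpB hp_cvg finHL cvL cvK.
have lb n := relval_bellman hA hq_nonneg hq_cons hc eA (alpha_gt0 n) hL (JE n) (JL n) i.
move=> /(_ lb); rewrite poisson.
have : 0 <= \esum_(k in [set: S]) (qo i k * (h k + L))%:E.
  by apply: esum_ge0 => k _; rewrite lee_fin mulr_ge0.
have : \esum_(k in [set: S]) (qo i k * (h k + L))%:E < +oo.
  by have := poisson i; case: (\esum_(k in _) _) => // r _; rewrite ltry.
case: (\esum_(k in _) _) => // r _ _.
rewrite -!EFinD lee_fin mul0r addr0 => le.
by have := Phi0 i; lra.
Qed.

Lemma gap0_passage i G : inRclass q e i G ->
  \esum_(k in [set: S]) (fpdist q e i G k * (H k)%:E) < +oo -> Phi i = 0%R.
Proof.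
move=> [hit1]; rewrite /mfp hit1 eqxx -/(pot q e i G (fun l => ((qex l)^-1)%:E)) => mfin finH.
pose r l : \bar R := ((qex l)^-1)%:E.
pose rc l : \bar R := ((qex l)^-1 * ce l)%:E.
pose rP l : \bar R := ((qex l)^-1 * Phi l)%:E.
pose hs l : \bar R := (h l + L)%:E.
have r0 l : 0 <= r l by rewrite lee_fin invr_ge0.
have rc0 l : 0 <= rc l by rewrite lee_fin mulr_ge0// invr_ge0.
have rP0 l : 0 <= rP l by rewrite lee_fin mulr_ge0// invr_ge0.
have hsE0 l : 0 <= hs l by rewrite lee_fin.
have fp0 k : 0 <= fpdist q e i G k by exact: (fpdist_ge0 qo0 sum_qo).
have in0 l : 0 <= step_in q e G hs l by exact: (step_in_ge0 qo0 sum_qo).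
have fpfin k : fpdist q e i G k \is a fin_num.
  rewrite ge0_fin_numE//; apply: (@le_lt_trans _ _ 1); last exact: ltry.
  by rewrite -(sum_fpdist hit1); exact: esumT_ge.
pose fp k := fine (fpdist q e i G k).
have fpE k : fpdist q e i G k = (fp k)%:E by rewrite /fp fineK.
have fpR0 k : (0 <= fp k)%R by rewrite -lee_fin -fpE.
(* Here the Poisson equation of the limit is iterated; [pot_ge] asks for no integrability of [h]
   along the chain. *)
have low : pot q e i G rc + pot q e i G rP + \esum_(k in [set: S]) (fp k * (h k + L))%:E
    <= hs i + g%:E * pot q e i G r.
  have -> : \esum_(k in [set: S]) (fp k * (h k + L))%:E = pot q e i G (step_in q e G hs).
    by rewrite (pot_step_in qo0 sum_qo)//; apply: eq_esum => k _; rewrite fpE EFinM.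
  rewrite -(potZ qo0 sum_qo) ?lee_fin// -!(potD qo0 sum_qo)//; last by move=> l; exact: adde_ge0.
  apply: (pot_ge qo0 sum_qo) => //.
  - by move=> l; rewrite mule_ge0// lee_fin.
  - by move=> l; rewrite !adde_ge0.
  - move=> n l tN0; have qN0 := taboo_nonabsorbing qo0 sum_qo hit1 tN0.
    rewrite -[leLHS]addeA (step_inD_out qo0 sum_qo)// (sum_pjump qo0 sum_qo)//.
    have X0 : 0 <= \esum_(k in [set: S]) (qo l k * (h k + L))%:E.
      by apply: esum_ge0 => k _; rewrite lee_fin mulr_ge0.
    have := congr1 (fun x => r l * x) (poisson l).
    rewrite [in X in _ = X -> _]ge0_muleDr//; last by rewrite lee_fin addr_ge0.
    rewrite (_ : r l * (qex l * (h l + L) + g)%:E = hs l + g%:E * r l); last first.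
      by rewrite -!EFinM -EFinD; congr EFin; field.
    rewrite (_ : r l * (ce l + Phi l)%:E = rc l + rP l); last first.
      by rewrite -!EFinM -EFinD; congr EFin; ring.
    by move=> ->; rewrite lexx.
have potr0 : 0 <= pot q e i G r by exact: (pot_ge0 qo0 sum_qo).
have potc0 : 0 <= pot q e i G rc by exact: (pot_ge0 qo0 sum_qo).
have potP0 : 0 <= pot q e i G rP by exact: (pot_ge0 qo0 sum_qo).
have X0 : 0 <= \esum_(k in [set: S]) (fp k * (h k + L))%:E.
  by apply: esum_ge0 => k _; rewrite lee_fin mulr_ge0.
have [m mE] : exists m, pot q e i G r = m%:E.
  by exists (fine (pot q e i G r)); rewrite fineK// ge0_fin_numE.
have fin_of (x y : \bar R) : 0 <= x -> x <= y -> y < +oo -> exists z, x = z%:E.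
  move=> x0 xy yoo; exists (fine x); rewrite fineK// ge0_fin_numE//.
  exact: le_lt_trans yoo.
have rhs_fin : hs i + g%:E * pot q e i G r < +oo by rewrite mE -EFinM -EFinD ltry.
(* The mean passage time being finite, [low] itself shows that the expected cost up to passage is
   finite, as [relval_passage] requires. *)
have [C CE] : exists C, pot q e i G rc = C%:E.
  apply: fin_of rhs_fin => //; apply: le_trans low.
  by rewrite -addeA leeDl// adde_ge0.
have [P PE] : exists P, pot q e i G rP = P%:E.
  apply: fin_of rhs_fin => //; apply: le_trans low.
  by rewrite addeAC leeDr// adde_ge0.
have [X XE] : exists X, \esum_(k in [set: S]) (fp k * (h k + L))%:E = X%:E.
  by apply: fin_of rhs_fin => //; apply: le_trans low; rewrite leeDr// adde_ge0.
have fpD (u : R) : (0 <= u)%R -> \esum_(k in [set: S]) (fp k * (H k + u))%:E < +oo.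
  move=> u0; under eq_esum do rewrite mulrDr EFinD.
  rewrite esumD; try by move=> k _; rewrite lee_fin mulr_ge0.
  rewrite lte_add_pinfty//.
    by under eq_esum do rewrite EFinM -fpE.
  under eq_esum do rewrite EFinM -fpE.
  by rewrite esumZr ?lee_fin// (sum_fpdist hit1) mul1e ltry.
have up n : (hp n i + alpha n * J n i0 * m)%:E <= (C + alpha n * L * m)%:E +
    \esum_(k in [set: S]) (fp k * hp n k)%:E.
  have rcfin : pot q e i G rc < +oo by rewrite CE ltry.
  have fpJ : \esum_(k in [set: S]) (fpdist q e i G k * (J n k)%:E) < +oo.
    apply: le_lt_trans (fpD _ (J0 n i0)); apply: le_esum => k _.
    rewrite fpE -EFinM lee_fin ler_wpM2l// -lerBlDr -lee_fin -hrelE.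
    exact: hrelH.
  have := relval_passage hA hq_nonneg hq_cons hc eA (alpha_gt0 n) hL (JE n) (JL n)
    hit1 rcfin fpJ.
  rewrite -/r -/rc CE mE -!EFinM -!EFinD => /le_trans; apply.
  rewrite leeD2l//; apply: le_esum => k _.
  by rewrite fpE -EFinM.
have cvy : (hp n i + alpha n * J n i0 * m)%R @[n --> \oo] --> (h i + L + g * m)%R.
  by apply: cvgD; [exact: hp_cvg|apply: cvgMr_tmp; exact: theta_cvg].
have cvK : (C + alpha n * L * m)%R @[n --> \oo] --> (C + 0 * L * m)%R.
  by apply: cvgD; [exact: cvg_cst|do 2 apply: cvgMr_tmp].
have := esum_dominated_limit fpR0 hpB hp_cvg (fpD _ hL) cvy cvK up.
move: low; rewrite XE CE PE mE -!EFinM /hs -!EFinD !lee_fin !mul0r addr0 => le1 le2.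
have P_le0 : (P <= 0)%R by lra.
have pot0 : pot q e i G rP = 0.
  by apply/eqP; rewrite eq_le potP0 PE lee_fin P_le0.
(* The term of index [0] in this vanishing sum is [Phi i / qex i]. *)
have := esum_eq0 (fun n => tsum_ge0 qo0 sum_qo i G n rP0) pot0 0%N.
rewrite tsum0// => -[/eqP]; rewrite mulf_eq0 invr_eq0.
have qN0 : qex i != 0%R.
  by apply: (taboo_nonabsorbing qo0 sum_qo hit1 (n := 0%N)); rewrite /= eqxx eqe oner_eq0.
by rewrite (negPf qN0) => /eqP.
Qed.

End VanishingDiscount.

Theorem theorem1 (R : realType) (S : countType) (Act : choiceType)
  (A : S -> {fset Act}) (q : S -> Act -> S -> R) (c : S -> Act -> R)
  (* the CTMDP model *)
  (hA : forall i, A i != fset0)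
  (hq_nonneg : forall i a j, a \in A i -> j != i -> (0 <= q i a j)%R)
  (hq_cons : forall i a, a \in A i -> sumS (fun j => q i a j) = 0)
  (hc : forall i a, a \in A i -> (0 <= c i a)%R)
  (hnonexp : nonexplosive A q)
  (* Assumptions A *)
  (alpha : nat -> R) (i0 : S) (H : S -> R) (L : R)
  (halpha_dec : forall n, (alpha n.+1 < alpha n)%R)
  (halpha_lim : alpha @ \oo --> 0%R)
  (A1 : exists M : R, forall n, (alpha n)%:E * Jstar A q c (alpha n) i0 <= M%:E)
  (hH : forall i, (0 <= H i)%R)
  (A2 : forall i n, hrel A q c (alpha n) i0 i <= (H i)%:E)
  (hL : (0 <= L)%R)
  (A3 : forall i n, (- L)%:E <= hrel A q c (alpha n) i0 i)
  (* limits along a subsequence *)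
  (nk : nat -> nat) (hnk : forall k, (nk k < nk k.+1)%N)
  (gstar : R) (hstar : S -> R)
  (hg : (fun k => (alpha (nk k))%:E * Jstar A q c (alpha (nk k)) i0) @ \oo
          --> gstar%:E)
  (hh : forall j, (fun k => hrel A q c (alpha (nk k)) i0 j) @ \oo --> (hstar j)%:E)
  (* average-cost optimality inequality *)
  (ACOI : forall i, actmin A i (fun a => (c i a)%:E + sumS (fun j => (hstar j * q i a j)%R))
                    <= gstar%:E)
  (* e: stationary policy attaining the minimum *)
  (e : S -> Act)
  (he : forall i, e i \in A i /\
     (c i (e i))%:E + sumS (fun j => (hstar j * q i (e i) j)%R)
       = actmin A i (fun a => (c i a)%:E + sumS (fun j => (hstar j * q i a j)%R)))
  (* Phi >= 0 *)
  (Phi : S -> R) (hPhi0 : forall i, (0 <= Phi i)%R)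
  (hPhi : forall i, gstar%:E =
      (c i (e i) + Phi i)%:E + sumS (fun j => (hstar j * q i (e i) j)%R))
  (i : S) :
  ((exists G : set S, G !=set0 /\ inRclass q e i G /\
       \esum_(j in G) ((H j)%:E * fpdist q e i G j) < +oo)
   \/ inRclass q e i [set i0]
   \/ posrec q e i
   \/ (forall a, a \in A i -> \esum_(j in setT) (`|q i a j| * H j)%:E < +oo)) ->
  Phi i = 0%R /\
  gstar%:E = actmin A i (fun a => (c i a)%:E + sumS (fun j => (hstar j * q i a j)%R)).
Proof.
move=> cases; suff Phi_i0 : Phi i = 0%R.
  by split => //; have [_ <-] := he i; rewrite (hPhi i) Phi_i0 addr0.
have eA l : e l \in A l by have [] := he l.
(* The sequence decreases strictly to [0], so [alpha n > alpha n.+1 >= 0]. *)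
have alpha_gt0 n : (0 < alpha n)%R.
  apply: le_lt_trans (halpha_dec n).
  have /nonincreasing_seqP dec : forall m, (alpha m.+1 <= alpha m)%R by move=> m; exact: ltW.
  have cva : cvgn alpha by apply/cvg_ex; exists 0%R.
  have := nonincreasing_cvgn_ge dec cva n.+1.
  by rewrite (cvg_lim _ halpha_lim).
have nk_cvg : nk @ \oo --> \oo.
  apply/cvgnyPge => N; exists N => // n /= Nn.
  apply: leq_trans Nn _; elim: n => // n IH; exact: leq_ltn_trans IH (hnk n).
have Jge n l : 0 <= Jstar A q c (alpha n) l by exact: Jstar_ge0.
have J0fin n : Jstar A q c (alpha n) i0 < +oo.
  have [M /(_ n)] := A1; have := Jge n i0.
  case: (Jstar A q c (alpha n) i0) => // [r _ _|_]; first exact: ltry.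
  by rewrite gt0_muley ?lte_fin// leye_eq.
pose J n l := fine (Jstar A q c (alpha (nk n)) l).
(* Finiteness at [i0] comes from (A1), and (A2) carries it over to every state. *)
have JE n l : Jstar A q c (alpha (nk n)) l = (J n l)%:E.
  rewrite /J fineK// ge0_fin_numE//.
  have i0fin : Jstar A q c (alpha (nk n)) i0 \is a fin_num by rewrite ge0_fin_numE.
  have := A2 l (nk n); rewrite /hrel leeBlDr// => /le_lt_trans; apply.
  by rewrite lte_add_pinfty// ltry.
have alphak_gt0 n := alpha_gt0 (nk n).
have alphak_cvg : (alpha \o nk) @ \oo --> 0%R by exact: cvg_comp nk_cvg halpha_lim.
have one_step := gap0_one_step hA hq_nonneg hq_cons hc alphak_gt0 alphak_cvg JE hH
  (fun l n => A2 l (nk n)) hL (fun l n => A3 l (nk n)) hg hh eA hPhi0 hPhi.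
have passage := gap0_passage hA hq_nonneg hq_cons hc alphak_gt0 alphak_cvg JE hH
  (fun l n => A2 l (nk n)) hL (fun l n => A3 l (nk n)) hg hh eA hPhi0 hPhi.
have qo0 := stat_off_ge0 hq_nonneg eA.
have sum_qo := stat_off_sum hq_nonneg hq_cons eA.
have from_G G : inRclass q e i G ->
    \esum_(j in G) ((H j)%:E * fpdist q e i G j) < +oo -> Phi i = 0%R.
  move=> iG finG; apply: (passage i G) => //; move: finG; rewrite esum_mkcond.
  apply: le_lt_trans; apply: le_esum => k _; case: ifPn => kG; first by rewrite muleC.
  by rewrite /fpdist (negPf kG) mul0e.
(* For a one-point target the sum against [H] is a single finite term, which covers condition (ii)
   and recurrence in (iii). *)
have from_singleton k : inRclass q e i [set k] -> Phi i = 0%R.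
  move=> ik; apply: (from_G _ ik); have [hit1 _] := ik.
  have fp0 := fpdist_ge0 qo0 sum_qo i [set k] k.
  rewrite esum_set1; last by rewrite mule_ge0// lee_fin.
  rewrite lte_mul_pinfty ?lee_fin//; apply: (@le_lt_trans _ _ 1); last exact: ltry.
  rewrite -(sum_fpdist hit1); apply: esumT_ge => j; exact: (fpdist_ge0 qo0 sum_qo).
case: cases => [[G [_ [iG finG]]]|[|[[qi0|]|finH]]].
- exact: from_G finG.
- exact: from_singleton.
(* At an absorbing state all off-diagonal rates vanish, so the sum against [H] is [0]. *)
- apply: one_step; rewrite esum1 ?ltry// => k _.
  have qoE j : 0 <= (qoff q i (e i) j)%:E by rewrite lee_fin.
  by have := sum_qo i; rewrite qi0 => /(esum_eq0 qoE)/(_ k)[->]; rewrite mul0r.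
- exact: from_singleton.
- apply: one_step; apply: le_lt_trans (finH _ (eA i)); apply: le_esum => k _.
  rewrite lee_fin ler_wpM2r// /qoff; case: eqVneq => // _.
  exact: ler_norm.
Qed.
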